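(* Let $N\ge2$, let $\alpha>0$ be a constant and $T>0$. Let $f$ be a non-negative, bounded and measurable function on $\mathbb{R}^N\times(0,T)$. For a unit vector $m\in\mathbb{R}^N$ let $P_m$ be the orthogonal projection $P_mx=x-(x\cdot m)m$, $x\in\mathbb{R}^N$; identify $P_m\mathbb{R}^N$ with $\mathbb{R}^{N-1}$ and write $x'=P_mx$. Let $s_0:\mathbb{R}^{N-1}\to\mathbb{R}$ be a $C^2$ function with bounded derivatives up to second order. Let $$D_0=\{x\in\mathbb{R}^N \mid s_0(x')<x\cdot m\},\qquad u_0\equiv0.$$ Then there exists no solution $(u,S(t))$ on $(0,T)$ (in the sense defined in the context) to the free boundary problem $$\partial_t u-\Delta u=f \ \text{ in } Q_T,\qquad u=0 \ \text{ on } S_T,\qquad \partial u/\partial\nu=-\alpha \ \text{ on } S_T,$$ with initial data $u|_{t=0}=u_0$, $S(t)|_{t=0}=S_0=\partial D_0$.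
   Context: Notation. $D(t)\subset\mathbb{R}^N$ $(0<t<T)$ are domains with boundary $S(t)=\partial D(t)$; $Q_T=\bigcup_{0<t<T}D(t)\times\{t\}$, $S_T=\bigcup_{0<t<T}S(t)\times\{t\}$; $\partial/\partial\nu$ is the exterior normal derivative of $D(t)$ on $S(t)$. Both $u$ and the free boundary $S(t)$ are unknown. Solution of the equations. A solution is a classical non-negative solution: $u=u(x,t)\ge0$ is $C^2$ in $x$ and $C^1$ in $t$ in $Q_T$, with $\nabla^2u,\partial_tu\in C(Q_T)$ and $u,\nabla u\in C(Q_T\cup S_T)$, satisfying the equation in $Q_T$ and the boundary conditions on $S_T$; moreover $S_T$ is uniformly $C^{2,1}$ ($C^2$ in space, $C^1$ in time) in $\mathbb{R}^N\times(\varepsilon,T)$ for every $\varepsilon>0$. Solution of the initial value problem. In addition, $u$ is bounded and is continuous up to $t=0$ on $\overline{D_0}$ with value $u_0$ there (i.e. $u$ extended by $u_0$ on $\overline{D_0}\times\{0\}$ is continuous), and $S(t)\to S_0$ as $t\downarrow0$ in the uniform $C^2$ topology. No control of the time derivative of $S(t)$ up to $t=0$ is assumed. In the present situation this means $D(t)=\{x\in\mathbb{R}^N\mid s(t,x')<x\cdot m\}$, where $s$ is $C^1$ in $t$ and $C^2$ in $x'$ on $(0,T)\times\mathbb{R}^{N-1}$, $\partial_ts$ and the first and second order $x'$-derivatives of $s$ are bounded on $(\varepsilon,T)\times\mathbb{R}^{N-1}$ for every $\varepsilon>0$, and $s(t,\cdot)-s_0$ together with its $x'$-derivatives up to second order tends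 to $0$ uniformly on $\mathbb{R}^{N-1}$ as $t\downarrow0$. *)

(* Defs.v *)
From HB Require Import structures.
From mathcomp Require Import all_boot all_order all_algebra.
From mathcomp Require Import all_classical all_reals all_analysis.
Set Implicit Arguments.
Unset Strict Implicit.
Unset Printing Implicit Defensive.
Import Order.TTheory GRing.Theory Num.Theory.
Import numFieldNormedType.Exports.
Local Open Scope classical_set_scope.
Local Open Scope ring_scope.

(* Points of R^n are row vectors.  The library norm `|x| on them is the sup
   norm; it is used below only for boundedness and uniform convergence, where
   the choice of norm is immaterial. *)

Definition dot (R : realType) (n : nat) (x y : 'rV[R]_n) : R :=
  \sum_(i < n) x 0 i * y 0 i.

Definition enorm (R : realType) (n : nat) (x : 'rV[R]_n) : R :=
  Num.sqrt (dot x x).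

Definition partial (R : realType) (n : nat) (i : 'I_n) (g : 'rV[R]_n -> R)
    (x : 'rV[R]_n) : R := 'D_(delta_mx 0 i) g x.

Definition grad (R : realType) (n : nat) (g : 'rV[R]_n -> R) (x : 'rV[R]_n)
    : 'rV[R]_n := \row_i partial i g x.

Definition hess (R : realType) (n : nat) (g : 'rV[R]_n -> R) (x : 'rV[R]_n)
    : 'M[R]_n := \matrix_(i, j) partial j (partial i g) x.

Definition laplacian (R : realType) (n : nat) (g : 'rV[R]_n -> R)
    (x : 'rV[R]_n) : R := \sum_(i < n) partial i (partial i g) x.

Definition twice_derivable (R : realType) (n : nat) (g : 'rV[R]_n -> R)
    (x : 'rV[R]_n) : Prop :=
  (forall i : 'I_n, derivable g x (delta_mx 0 i)) /\
  (forall i j : 'I_n, derivable (partial i g) x (delta_mx 0 j)).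

Definition C2 (R : realType) (n : nat) (g : 'rV[R]_n -> R) : Prop :=
  [/\ forall x, twice_derivable g x,
      continuous g,
      continuous (grad g) &
      continuous (hess g)].

(* C^2 in space and C^1 in time on the set A of space-time points (x, t); A is
   meant to be open, so that the derivatives on A depend only on w on A. *)
Record C21 (R : realType) (n : nat) (A : set ('rV[R]_n * R))
    (w : 'rV[R]_n -> R -> R) : Prop := {
  C21_space : forall p, A p -> twice_derivable (w^~ p.2) p.1;
  C21_time : forall p, A p -> derivable (w p.1) p.2 1;
  C21_cont : {within A, continuous (fun p => w p.1 p.2)};
  C21_dt : {within A, continuous (fun p => derive1 (w p.1) p.2)};
  C21_grad : {within A, continuous (fun p => grad (w^~ p.2) p.1)};
  C21_hess : {within A, continuous (fun p => hess (w^~ p.2) p.1)} }.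

Definition proj (R : realType) (N : nat) (m x : 'rV[R]_N) : 'rV[R]_N :=
  x - dot x m *: m.

(* The rows of B are an orthonormal basis of the hyperplane P_m R^N = m^\perp:
   such a B is an identification of P_m R^N with R^(N-1). *)
Definition hyperplane_frame (R : realType) (N : nat) (m : 'rV[R]_N)
    (B : 'M[R]_(N.-1, N)) : Prop :=
  B *m B^T = 1%:M /\ (forall i, dot (row i B) m = 0).

(* x' = P_m x, read in R^(N-1) through the identification B. *)
Definition tcoord (R : realType) (N : nat) (m : 'rV[R]_N)
    (B : 'M[R]_(N.-1, N)) (x : 'rV[R]_N) : 'rV[R]_N.-1 :=
  proj m x *m B^T.

Definition epigraph (R : realType) (N : nat) (m : 'rV[R]_N)
    (B : 'M[R]_(N.-1, N)) (h : 'rV[R]_N.-1 -> R) : set 'rV[R]_N :=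
  [set x | h (tcoord m B x) < dot x m].

(* Here and below s is applied as s x' t: space first, as for u x t. *)
Definition moving_domain (R : realType) (N : nat) (m : 'rV[R]_N)
    (B : 'M[R]_(N.-1, N)) (s : 'rV[R]_N.-1 -> R -> R) (t : R)
    : set 'rV[R]_N := epigraph m B (s^~ t).

(* The epigraph of h is {phi > 0} with phi x = x . m - h x', so its exterior
   unit normal is - grad phi / |grad phi|. *)
Definition exterior_normal (R : realType) (N : nat) (m : 'rV[R]_N)
    (B : 'M[R]_(N.-1, N)) (h : 'rV[R]_N.-1 -> R) (x : 'rV[R]_N) : 'rV[R]_N :=
  let g := grad (fun y => dot y m - h (tcoord m B y)) x in
  - (enorm g)^-1 *: g.

Definition boundary (X : topologicalType) (A : set X) : set X :=
  closure A `\` interior A.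

Section space_time.
Context (R : realType) (N : nat) (T : R) (D : R -> set 'rV[R]_N).

Definition QT : set ('rV[R]_N * R) :=
  [set p : 'rV[R]_N * R | 0 < p.2 < T /\ D p.2 p.1].

Definition ST : set ('rV[R]_N * R) :=
  [set p : 'rV[R]_N * R | 0 < p.2 < T /\ boundary (D p.2) p.1].

End space_time.

(* The field G_ is the continuous extension of
   grad u from Q_T to Q_T `|` S_T, which gives the normal derivative on S_T. *)
Record classical_solution (R : realType) (N : nat) (m : 'rV[R]_N)
    (B : 'M[R]_(N.-1, N)) (T alpha : R) (f : 'rV[R]_N -> R -> R)
    (u : 'rV[R]_N -> R -> R) (s : 'rV[R]_N.-1 -> R -> R) : Prop := {
  sol_s_reg : C21 [set p : 'rV[R]_N.-1 * R | 0 < p.2 < T] s;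
  sol_s_bounded : forall eps : R, 0 < eps -> exists M : R, forall y (t : R),
    eps < t < T ->
    [/\ `|derive1 (s y) t| <= M, `|grad (s^~ t) y| <= M & `|hess (s^~ t) y| <= M];
  sol_u_ge0 : forall p, QT T (moving_domain m B s) p -> 0 <= u p.1 p.2;
  sol_u_reg : C21 (QT T (moving_domain m B s)) u;
  sol_u_cont : {within QT T (moving_domain m B s)
                       `|` ST T (moving_domain m B s),
    continuous (fun p => u p.1 p.2)};
  sol_eq : forall p, QT T (moving_domain m B s) p ->
    derive1 (u p.1) p.2 - laplacian (u^~ p.2) p.1 = f p.1 p.2;
  sol_dirichlet : forall p, ST T (moving_domain m B s) p ->
    u p.1 p.2 = 0;
  sol_neumann : exists G_ : 'rV[R]_N * R -> 'rV[R]_N,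
    [/\ {within QT T (moving_domain m B s)
                `|` ST T (moving_domain m B s), continuous G_},
        forall p, QT T (moving_domain m B s) p ->
          G_ p = grad (u^~ p.2) p.1 &
        forall p, ST T (moving_domain m B s) p ->
          dot (G_ p) (exterior_normal m B (s^~ p.2) p.1) = - alpha] }.

Record initial_value_solution (R : realType) (N : nat) (m : 'rV[R]_N)
    (B : 'M[R]_(N.-1, N)) (T alpha : R) (f : 'rV[R]_N -> R -> R)
    (u0 : 'rV[R]_N -> R) (s0 : 'rV[R]_N.-1 -> R)
    (u : 'rV[R]_N -> R -> R) (s : 'rV[R]_N.-1 -> R -> R) : Prop := {
  ivs_solution : classical_solution m B T alpha f u s;
  ivs_u_bounded : exists M : R, forall p,
    QT T (moving_domain m B s) p -> `|u p.1 p.2| <= M;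
  ivs_u_init : forall x, closure (epigraph m B s0) x -> u x 0 = u0 x;
  ivs_u_cont : {within QT T (moving_domain m B s)
                       `|` ST T (moving_domain m B s)
                       `|` closure (epigraph m B s0) `*` [set 0],
    continuous (fun p => u p.1 p.2)};
  ivs_s_init : forall eps : R, 0 < eps -> \forall t \near 0^'+, forall y,
    [/\ `|s y t - s0 y| < eps,
        `|grad (s^~ t) y - grad s0 y| < eps &
        `|hess (s^~ t) y - hess s0 y| < eps] }.

(* Lebesgue measurability in R^n x R: measurability in the sense of
   Caratheodory for the Lebesgue outer measure, the latter defined through
   countable covers by boxes with corners lo and hi. *)
Section lebesgue_measurability.
Context (R : realType) (n : nat).
Implicit Types lo hi : 'rV[R]_n * R.

Definition st_box lo hi : set ('rV[R]_n * R) :=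
  [set p : 'rV[R]_n * R |
           (forall i, lo.1 0 i <= p.1 0 i <= hi.1 0 i) /\
           lo.2 <= p.2 <= hi.2].

Definition st_box_volume lo hi : R :=
  (\prod_(i < n) Num.max 0 (hi.1 0 i - lo.1 0 i)) * Num.max 0 (hi.2 - lo.2).

Definition st_outer_measure (X : set ('rV[R]_n * R)) : \bar R :=
  ereal_inf [set (\sum_(k <oo) (st_box_volume (lohi k).1 (lohi k).2)%:E)%E |
    lohi in [set lohi : nat -> ('rV[R]_n * R) * ('rV[R]_n * R) |
      X `<=` \bigcup_k st_box (lohi k).1 (lohi k).2]].

Definition st_measurable_fun (A : set ('rV[R]_n * R))
    (g : 'rV[R]_n * R -> R) : Prop :=
  forall Y : set R, measurable Y ->
    st_outer_measure.-caratheodory (A `&` g @^-1` Y).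

End lebesgue_measurability.

(* Main.v *)
Require Import Defs.
From mathcomp Require Import all_boot all_order all_algebra.
From mathcomp Require Import all_classical all_reals all_analysis.
From mathcomp Require Import ring lra.
Set Implicit Arguments.
Unset Strict Implicit.
Unset Printing Implicit Defensive.
Import Order.TTheory GRing.Theory Num.Theory.
Import numFieldNormedType.Exports.
Local Open Scope classical_set_scope.
Local Open Scope ring_scope.

(** By time t a bounded source has only supplied heat of order t: the maximum
principle gives u <= (|M| + 1) t ([u_le_linear]).  On the free boundary, however,
u has to leave 0 with slope alpha.  A layer of height O(t) and slope alpha is
of width O(t), and in the heat equation such a layer is a travelling wave of
speed of order 1/t which retreats into the domain.  As the integral of 1/t
diverges at 0, the boundary would have to move infinitely far in no time,
whereas S(t) tends to S_0.

The proof turns this into one comparison with an upper barrier that moves at a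
constant speed c.  Over the unit ball of R^(N-1) let
<<
    phi(x,t) = x . m + K |x'|^2 - c0 - (c t - w),
    V = profile(phi),   profile(z) = b z - g z^2.
>>
The set {phi > 0} is the part of space above a concave paraboloid, which rises
with speed c, and close to the paraboloid V is a supersolution with slope less
than alpha:
- inside the domain the concavity of the profile beats both the source and the
  motion of the paraboloid, so that V cannot be touched from below by u for the
  first time there ([interior_contact], [barrier_interior_contact]);
- at a free boundary point a first contact would bound alpha by the slope of V
  ([boundary_contact], [barrier_boundary_contact]);
- K and c0 are such that the paraboloid touches the graph of s0 from below at
  an interior point of the unit ball and lies at least 1 below it over the unit
  sphere ([paraboloid_touching_inside]), which keeps contacts away from the
  lateral boundary; they are kept away from the top, where phi = dl, by the
  bound u <= (|M| + 1) t.

The paraboloid starts w below the graph of s0, and it is 3 w above at time t0 at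
the point of tangency, where w bounds the distance of s to s0 up to time t0; so
it has overtaken the free boundary, and a contact has taken place.  All this
needs c t0 = 4 w, hence g of order b c = 4 b w / t0, and the barrier is of height
b^2 / (4 g), of order b t0 / w.  This is more than (|M| + 1) t0 as soon as w is
small enough ([barrier_parameters]): it is here that the linear bound on u is
essential. *)

(** * Derivatives along lines *)

(** In this form, explicit points of the neighbourhood can be plugged in. *)
Lemma near_norm (R : realType) (V : normedModType R) (x : V) (P : set V) :
  (\forall y \near x, P y) ->
  exists2 r : R, 0 < r & forall y, `|x - y| < r -> P y.
Proof. by move=> /nbhs_normP[r /= r0 Hr]; exists r. Qed.

Lemma near_intro (R : realType) (V : normedModType R) (x : V) (P : set V) (r : R) :
  0 < r -> (forall y, `|x - y| < r -> P y) -> \forall y \near x, P y.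
Proof. by move=> r0 H; apply/nbhs_normP; exists r. Qed.

Lemma continuous_dist (R : realType) (V : normedModType R) (g : V -> R) x :
  {for x, continuous g} -> forall e : R, 0 < e ->
  \forall y \near x, `|g x - g y| < e.
Proof. by move=> /cvgrPdist_lt H e e0; exact: H. Qed.

Lemma within_continuous_dist (R : realType) (V W : normedModType R) (A : set V)
    (g : V -> W) x :
  {within A, continuous g} -> A x -> forall e : R, 0 < e ->
  \forall y \near x, A y -> `|g x - g y| < e.
Proof.
move=> /subspace_continuousP cg Ax e e0.
by have /cvgrPdist_lt/(_ e e0) := cg x Ax; rewrite near_withinE.
Qed.

Lemma continuous_of_dist (R : realType) (V W : normedModType R) (g : V -> W) (x : V) :
  (forall e : R, 0 < e -> exists2 r : R, 0 < r &
     forall y, `|x - y| < r -> `|g x - g y| < e) ->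
  {for x, continuous g}.
Proof.
move=> H; apply/cvgrPdist_lt => e /H[r r0 Hr].
by apply/nbhs_normP; exists r.
Qed.

(** In increment form, restricting a function to a line is a mere rewriting. *)
Lemma is_derive_expansion (R : realType) (V : normedModType R) (f : V -> R)
    (x v : V) (l : R) :
  is_derive x v f l <->
  forall e : R, 0 < e -> exists2 r : R, 0 < r &
    forall h : R, `|h| < r -> `|f (x + h *: v) - f x - h * l| <= e * `|h|.
Proof.
have quotient (h d b : R) : h != 0 -> `|d - h * b| = `|b - h^-1 *: d| * `|h|.
  move=> h0; rewrite -normrM mulrBl -[h^-1 *: d]/(h^-1 * d) distrC.
  by rewrite (mulrC b) mulrAC mulVf// mul1r.
split=> [[dfx <-] e e0|H].
- have /cvgrPdist_le/(_ _ e0) := dfx.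
  rewrite near_withinE => /nbhs_ballP[r /= r0 Hr].
  exists r => // h hr; have [->|h0] := eqVneq h 0.
    by rewrite scale0r addr0 subrr mul0r subr0 normr0 mulr0.
  have := Hr h; rewrite /ball/= sub0r normrN => /(_ hr h0) H.
  by rewrite quotient// ler_wpM2r// (addrC x).
- have cv : h^-1 *: (f (h *: v + x) - f x) @[h --> 0^'] --> (l : R).
    apply/cvgrPdist_le => e e0; have [r r0 Hr] := H e e0.
    rewrite near_withinE; apply/nbhs_ballP; exists r => //= h.
    rewrite /ball/= sub0r normrN => hr h0.
    by have := Hr h hr; rewrite quotient// ler_pM2r ?normr_gt0// (addrC x).
  apply: DeriveDef; first by apply/cvg_ex; exists l.
  exact: cvg_lim cv.
Qed.

Lemma is_derive_line (R : realType) (V : normedModType R) (f : V -> R)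
    (x v : V) (tau l : R) :
  is_derive (x + tau *: v) v f l ->
  is_derive tau 1 (fun h => f (x + h *: v)) l.
Proof.
move=> /is_derive_expansion H; apply/is_derive_expansion => e e0.
have [r r0 Hr] := H e e0; exists r => // h hr.
by rewrite -[h *: 1]/(h * 1) mulr1 scalerDl (addrA x) Hr.
Qed.

Lemma is_derive_line0 (R : realType) (V : normedModType R) (f : V -> R)
    (x v : V) (l : R) :
  is_derive x v f l <-> is_derive (0 : R) (1 : R) (fun h => f (x + h *: v)) l.
Proof.
split=> [H|/is_derive_expansion H].
  by apply: is_derive_line; rewrite scale0r addr0.
apply/is_derive_expansion => e e0; have [r r0 Hr] := H e e0.
exists r => // h /Hr.
by rewrite add0r -[h *: 1]/(h * 1) mulr1 scale0r addr0.
Qed.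

Lemma is_derive1_continuous (R : realType) (f : R -> R) (x l : R) :
  is_derive x 1 f l -> {for x, continuous f}.
Proof. by move=> [/derivable1_diffP df _]; exact: differentiable_continuous. Qed.

Lemma is_derive_fun_sub (R : realType) (g h : R -> R) (x dg dh : R) :
  is_derive x 1 g dg -> is_derive x 1 h dh ->
  is_derive x 1 (fun y => g y - h y) (dg - dh).
Proof. by move=> Dg Dh; exact: is_deriveB. Qed.

Lemma is_derive_fun_mul (R : realType) (g h : R -> R) (x dg dh : R) :
  is_derive x 1 g dg -> is_derive x 1 h dh ->
  is_derive x 1 (fun y => g y * h y) (g x * dh + h x * dg).
Proof. by move=> Dg Dh; exact: is_deriveM. Qed.

Lemma is_derive_quadratic (R : realType) (a b c x : R) :
  is_derive x 1 (fun k : R => a + b * k + c * k ^+ 2) (b + 2 * c * x).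
Proof.
apply/is_derive_expansion => e e0.
have c0 : 0 < `|c| + 1 by rewrite ltr_wpDl.
exists (e / (`|c| + 1)); first by rewrite divr_gt0.
move=> h; rewrite ltr_pdivlMr// => hr; rewrite -[h *: 1]/(h * 1) mulr1.
rewrite [X in `|X|](_ : _ = (h * c) * h); last by ring.
rewrite 2!normrM ler_wpM2r// (le_trans _ (ltW hr))//.
by rewrite ler_wpM2l// lerDl.
Qed.

(** Allowing for both signs of [tau] spares a case analysis on the coordinates of
the increment in [grad_expansion]. *)
Lemma MVT_dist_le (R : realType) (f f' : R -> R) (c e tau : R) :
  (forall z : R, `|z| <= `|tau| -> is_derive z 1 f (f' z)) ->
  (forall z : R, `|z| <= `|tau| -> `|f' z - c| <= e) ->
  `|f tau - f 0 - c * tau| <= e * `|tau|.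
Proof.
move=> df f'c.
have cont a b : (forall z, z \in `[a, b] -> `|z| <= `|tau|) ->
    {within `[a, b], continuous f}.
  move=> ab; apply: continuous_in_subspaceT => z; rewrite inE => zab.
  exact: is_derive1_continuous (df z (ab z zab)).
have [t0|t0|->] := ltgtP tau 0.
- have ht z : z \in `[tau, 0] -> `|z| <= `|tau|.
    rewrite in_itv/= => /andP[z1 z2].
    by rewrite ler0_norm// (ltr0_norm t0) lerN2.
  have dfo z (zt : z \in `]tau, 0[) := df z (ht z (subset_itv_oo_cc zt)).
  have [z zt fz] := MVT t0 dfo (cont _ _ ht).
  rewrite -(opprB (f 0)) fz sub0r mulrN opprK -mulrBl normrM.
  apply: ler_wpM2r => //.
  by rewrite f'c// ht// subset_itv_oo_cc.
- have ht z : z \in `[0, tau] -> `|z| <= `|tau|.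
    rewrite in_itv/= => /andP[z1 z2].
    by rewrite ger0_norm// (gtr0_norm t0).
  have dfo z (zt : z \in `]0, tau[) := df z (ht z (subset_itv_oo_cc zt)).
  have [z zt fz] := MVT t0 dfo (cont _ _ ht).
  rewrite fz subr0 -mulrBl normrM; apply: ler_wpM2r => //.
  by rewrite f'c// ht// subset_itv_oo_cc.
- by rewrite mulr0 subrr subr0 !normr0 mulr0.
Qed.

(** * Scalar product and gradient *)

Lemma dotC (R : realType) n (x y : 'rV[R]_n) : dot x y = dot y x.
Proof. by apply: eq_bigr => i _; rewrite mulrC. Qed.

Lemma dotDl (R : realType) n (x y z : 'rV[R]_n) : dot (x + y) z = dot x z + dot y z.
Proof. by rewrite -big_split; apply: eq_bigr => i _; rewrite !mxE mulrDl. Qed.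

Lemma dotZl (R : realType) n (a : R) (x z : 'rV[R]_n) : dot (a *: x) z = a * dot x z.
Proof. by rewrite mulr_sumr; apply: eq_bigr => i _; rewrite !mxE mulrA. Qed.

Lemma dotDr (R : realType) n (x y z : 'rV[R]_n) : dot z (x + y) = dot z x + dot z y.
Proof. by rewrite dotC dotDl !(dotC z). Qed.

Lemma dotZr (R : realType) n (a : R) (x z : 'rV[R]_n) : dot z (a *: x) = a * dot z x.
Proof. by rewrite dotC dotZl (dotC z). Qed.

Lemma dot0l (R : realType) n (x : 'rV[R]_n) : dot 0 x = 0.
Proof. by rewrite -(scale0r 0) dotZl mul0r. Qed.

Lemma dotNl (R : realType) n (x y : 'rV[R]_n) : dot (- x) y = - dot x y.
Proof. by rewrite -scaleN1r dotZl mulN1r. Qed.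

Lemma dotNr (R : realType) n (x y : 'rV[R]_n) : dot x (- y) = - dot x y.
Proof. by rewrite dotC dotNl dotC. Qed.

Lemma dot_ge0 (R : realType) n (x : 'rV[R]_n) : 0 <= dot x x.
Proof. by apply: sumr_ge0 => i _; rewrite -expr2 sqr_ge0. Qed.

Lemma dot_delta (R : realType) n (x : 'rV[R]_n) i : dot x (delta_mx 0 i) = x 0 i.
Proof.
rewrite /dot (bigD1 i)//= mxE !eqxx mulr1 big1 ?addr0// => j ji.
by rewrite mxE (negbTE ji) andbF mulr0.
Qed.

Lemma dot_mulmx (R : realType) n (x y : 'rV[R]_n) : dot x y = (x *m y^T) 0 0.
Proof. by rewrite mxE; apply: eq_bigr => i _; rewrite mxE. Qed.

Lemma ler_coord_norm (R : realType) n (x : 'rV[R]_n) i : `|x 0 i| <= `|x|.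
Proof. by rewrite [leRHS]mx_normrE; apply: (le_bigmax _ (fun i => `|x i.1 i.2|) (0, i)). Qed.

Lemma norm_rV_lt (R : realType) n (x : 'rV[R]_n) (r : R) : 0 < r ->
  (forall i, `|x 0 i| < r) -> `|x| < r.
Proof.
move=> r0 H; rewrite [ltLHS]mx_normrE; apply/bigmax_ltP; split => // -[i j] _.
by rewrite ord1.
Qed.

Lemma norm_rV_le (R : realType) n (x : 'rV[R]_n) (r : R) : 0 <= r ->
  (forall i, `|x 0 i| <= r) -> `|x| <= r.
Proof.
move=> r0 H; rewrite [leLHS]mx_normrE; apply/bigmax_leP; split => // -[i j] _.
by rewrite ord1.
Qed.

Lemma norm_le_dot (R : realType) n (x : 'rV[R]_n) (r : R) :
  dot x x <= r -> `|x| <= r + 1.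
Proof.
move=> xr; have r0 : 0 <= r := le_trans (dot_ge0 x) xr.
apply: norm_rV_le => [|i]; first by rewrite addr_ge0.
have : x 0 i * x 0 i <= r.
  apply: le_trans xr; rewrite /dot (bigD1 i)//= lerDl sumr_ge0// => j _.
  by rewrite -expr2 sqr_ge0.
by rewrite ler_norml; nra.
Qed.

(** A function with continuous partial derivatives is differentiable: an
increment [w] is a sum of [n] increments along the axes, and each of these is
controlled by the mean value theorem.  The sup norm is convenient here, because
the intermediate points stay in the ball. *)
Lemma grad_expansion (R : realType) n (g : 'rV[R]_n -> R) x :
  (\forall y \near x, forall i, derivable g y (delta_mx 0 i)) ->
  {for x, continuous (grad g)} ->
  forall e : R, 0 < e -> exists2 r : R, 0 < r & forall w, `|w| < r ->
    `|g (x + w) - g x - dot (grad g x) w| <= e * `|w|.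
Proof.
move=> dg cg e e0.
pose e' := e / n.+1%:R; have e'0 : 0 < e' by rewrite divr_gt0.
have /cvgrPdist_le/(_ _ e'0) cg' := cg.
have [r r0 Hr] := near_norm (filterI dg cg').
exists r => // w wr.
(* z interpolates between 0 and w along the axes. *)
pose z k : 'rV[R]_n := \row_(i < n) (if (i < k)%N then w 0 i else 0).
have zS (k : 'I_n) : z k.+1 = z k + w 0 k *: delta_mx 0 k.
  apply/rowP => i; rewrite !mxE eqxx/= ltnS leq_eqVlt.
  have [->|ik] /= := eqVneq i k; first by rewrite eqxx ltnn mulr1 add0r.
  by rewrite val_eqE (negbTE ik)/= mulr0 addr0.
have step k : (k <= n)%N ->
    `|g (x + z k) - g x - dot (grad g x) (z k)| <= k%:R * (e' * `|w|).
  elim: k => [_|k IHk kn].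
    have -> : z 0%N = 0 by apply/rowP => i; rewrite !mxE ltn0.
    by rewrite addr0 dotC dot0l !subrr normr0 mul0r.
  have /= := IHk (ltnW kn); set k' := Ordinal kn; rewrite -[k]/(val k') => IH.
  have zk' (tau : R) : `|tau| <= `|w 0 k'| ->
      `|x - (x + z k' + tau *: delta_mx 0 k')| < r.
    move=> tw; rewrite opprD addrA opprD addrA subrr sub0r.
    rewrite -opprD normrN; apply: norm_rV_lt => // i; rewrite !mxE eqxx/=.
    have [->|ik] := eqVneq i k'.
      rewrite ltnn add0r mulr1 (le_lt_trans tw)//.
      exact: le_lt_trans (ler_coord_norm _ _) wr.
    rewrite mulr0 addr0; case: ifP => _; last by rewrite normr0.
    exact: le_lt_trans (ler_coord_norm _ _) wr.
  have dline (h : R) : `|h| <= `|w 0 k'| ->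
      is_derive h 1 (fun h => g (x + z k' + h *: delta_mx 0 k'))
        (partial k' g (x + z k' + h *: delta_mx 0 k')).
    move=> hw; apply: is_derive_line; apply: derivableP.
    by have [H _] := Hr _ (zk' h hw); exact: H.
  have pline (h : R) : `|h| <= `|w 0 k'| ->
      `|partial k' g (x + z k' + h *: delta_mx 0 k') - grad g x 0 k'| <= e'.
    move=> hw; have [_ H] := Hr _ (zk' h hw); rewrite distrC.
    by have := le_trans (ler_coord_norm _ k') H; rewrite !mxE.
  have := MVT_dist_le dline pline.
  rewrite /= scale0r addr0 -(addrA x) -(zS k') => H.
  rewrite -natr1 mulrDl mul1r [X in dot _ X](zS k') dotDr dotZr dot_delta.
  rewrite [X in `|X|](_ : _ = (g (x + z k') - g x - dot (grad g x) (z k'))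
    + (g (x + z k'.+1) - g (x + z k') - grad g x 0 k' * w 0 k')); last by ring.
  rewrite (le_trans (ler_normD _ _))// lerD// (le_trans H)//.
  by rewrite ler_pM2l// ler_coord_norm.
have -> : w = z n by apply/rowP => i; rewrite !mxE ltn_ord.
have -> : `|z n| = `|w|.
  by congr (`|_|); apply/rowP => i; rewrite !mxE ltn_ord.
rewrite (le_trans (step n (leqnn n)))// mulrA ler_wpM2r//.
by rewrite /e' mulrCA ler_piMr ?(ltW e0)// ler_pdivrMr// mul1r ler_nat.
Qed.

(** This links the normal derivative, and the derivative of the height along the
normal, to the partial derivatives. *)
Lemma is_derive_grad (R : realType) n (g : 'rV[R]_n -> R) x d :
  (\forall y \near x, forall i, derivable g y (delta_mx 0 i)) ->
  {for x, continuous (grad g)} ->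
  is_derive x d g (dot (grad g x) d).
Proof.
move=> dg cg; apply/is_derive_expansion => e e0.
pose c := `|d| + 1; have c0 : 0 < c by rewrite ltr_wpDl.
have [r r0 Hr] := grad_expansion dg cg (divr_gt0 e0 c0).
exists (r / c); first by rewrite divr_gt0.
move=> h; rewrite ltr_pdivlMr// => hr; rewrite -dotZr.
have hd : `|h *: d| <= `|h| * c by rewrite normrZ ler_wpM2l// /c lerDl.
rewrite (le_trans (Hr _ (le_lt_trans hd hr)))//.
rewrite (le_trans (ler_wpM2l (ltW (divr_gt0 e0 c0)) hd))//.
by rewrite mulrA mulrAC divfK ?gt_eqF.
Qed.

(** * Derivative tests at a maximum *)

(** Were [w2] positive, [w1], which vanishes at the maximum, would be positive just
to the right of it, and [w] would increase there. *)
Lemma second_derivative_at_max (R : realType) (w w1 : R -> R) (w2 : R) :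
  (\forall h \near (0 : R), is_derive (h : R) 1 w (w1 h)) -> is_derive (0 : R) 1 w1 w2 ->
  (\forall h \near (0 : R), w h <= w 0) -> w2 <= 0.
Proof.
move=> dw /is_derive_expansion dw1 wmax; rewrite leNgt; apply/negP => w20.
have [r r0 Hr] := near_norm (filterI dw wmax).
have ballE (h : R) : `|h| < r -> is_derive h 1 w (w1 h) /\ w h <= w 0.
  by move=> hr; apply: Hr; rewrite sub0r normrN.
have w10 : w1 0 = 0.
  have [dw0 _] : is_derive (0 : R) 1 w (w1 0) /\ w 0 <= w 0.
    by apply: ballE; rewrite normr0.
  have itvE t : t \in `](- r), r[ -> `|t| < r.
    by rewrite in_itv/= ltr_norml.
  have d0 : is_derive (0 : R) 1 w 0.
    apply: (@derive1_at_max _ _ (- r) r).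
    - by rewrite ge0_cp// ltW.
    - by move=> t /itvE/ballE[].
    - by rewrite in_itv/= oppr_lt0 r0.
    - by move=> t /itvE/ballE[].
  by rewrite -(@derive_val _ _ _ _ _ _ _ dw0) (@derive_val _ _ _ _ _ _ _ d0).
have [q q0 Hq] := dw1 _ (divr_gt0 w20 (ltr0Sn _ 1)).
pose b := Num.min q r / 2.
have qr0 : 0 < Num.min q r by rewrite lt_min q0.
have b0 : 0 < b by rewrite divr_gt0.
have bq : b < Num.min q r by rewrite /b; lra.
have {bq} [bq br] : b < q /\ b < r by move: bq; rewrite lt_min => /andP[].
have w1gt0 h : 0 < h < q -> 0 < w1 h.
  move=> /andP[h0 hq]; have := Hq h; rewrite (gtr0_norm h0) => /(_ hq).
  rewrite w10 subr0 add0r -[h *: 1]/(h * 1) mulr1 ler_norml => /andP[+ _].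
  by have := mulr_gt0 h0 w20; lra.
have db h : h \in `]0, b[ -> is_derive h 1 w (w1 h).
  rewrite in_itv/= => /andP[h0 hb]; apply: (ballE _ _).1.
  by rewrite gtr0_norm// (lt_trans hb).
have cb : {within `[0, b], continuous w}.
  apply: continuous_in_subspaceT => h; rewrite inE/= in_itv/= => /andP[h0 hb].
  apply: is_derive1_continuous (ballE _ _).1.
  by rewrite ger0_norm// (le_lt_trans hb).
have [c] := MVT b0 db cb; rewrite in_itv/= subr0 => /andP[c0 cb'] wb.
have := mulr_gt0 (w1gt0 c _) b0; rewrite -wb c0 (lt_trans cb' bq) => /(_ erefl).
by rewrite subr_gt0 ltNge (ballE b _).2// gtr0_norm.
Qed.

Lemma derivative_ge0_of_left_max (R : realType) (w : R -> R) (t l : R) :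
  is_derive t 1 w l -> (\forall h \near t, h < t -> w h <= w t) -> 0 <= l.
Proof.
move=> /is_derive_expansion dw wmax; rewrite leNgt; apply/negP => l0.
have [r r0 Hr] := near_norm wmax.
have [q q0 Hq] := dw (- l / 2) ltac:(by lra).
pose b := Num.min q r / 2.
have qr0 : 0 < Num.min q r by rewrite lt_min q0.
have b0 : 0 < b by rewrite divr_gt0.
have bq : b < Num.min q r by rewrite /b; lra.
have {bq} [bq br] : b < q /\ b < r by move: bq; rewrite lt_min => /andP[].
have wb : w (t - b) <= w t.
  apply: Hr; last by rewrite ltrBlDr ltrDl.
  by rewrite opprB addrC subrK gtr0_norm.
have := Hq (- b); rewrite normrN (gtr0_norm b0) => /(_ bq).
rewrite -[_ *: 1]/(- b * 1) mulr1 ler_norml => /andP[+ _].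
by have := nmulr_rlt0 b l0; rewrite b0; nra.
Qed.

(** * Orthonormal coordinates along and across the axis *)

Section frame.
Context (R : realType) (N : nat) (m : 'rV[R]_N) (B : 'M[R]_(N.-1, N)).
Hypotheses (hm : enorm m = 1) (hB : hyperplane_frame m B).
Implicit Types (x d : 'rV[R]_N) (y : 'rV[R]_N.-1).

Lemma dot_axis : dot m m = 1.
Proof. by rewrite -[LHS]sqr_sqrtr ?dot_ge0// -/(enorm m) hm expr1n. Qed.

Lemma axis_mul_frame : m *m B^T = 0.
Proof.
apply/rowP => i; transitivity (dot (row i B) m); last by rewrite hB.2 mxE.
by rewrite mxE; apply: eq_bigr => j _; rewrite !mxE mulrC.
Qed.

Lemma tcoordE x : tcoord m B x = x *m B^T.
Proof. by rewrite /tcoord /proj mulmxBl -scalemxAl axis_mul_frame scaler0 subr0. Qed.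

Lemma tcoordD x d : tcoord m B (x + d) = tcoord m B x + tcoord m B d.
Proof. by rewrite !tcoordE mulmxDl. Qed.

Lemma tcoordZ (h : R) x : tcoord m B (h *: x) = h *: tcoord m B x.
Proof. by rewrite !tcoordE -scalemxAl. Qed.

Lemma tcoord_axis : tcoord m B m = 0.
Proof. by rewrite tcoordE axis_mul_frame. Qed.

Lemma dot_tcoord x y : dot (tcoord m B x) y = dot x (y *m B).
Proof. by rewrite !dot_mulmx tcoordE trmx_mul mulmxA. Qed.

Lemma dot_frame_axis y : dot (y *m B) m = 0.
Proof. by rewrite dotC -dot_tcoord tcoord_axis dot0l. Qed.

Lemma tcoord_frame y : tcoord m B (y *m B) = y.
Proof. by rewrite tcoordE -mulmxA hB.1 mulmx1. Qed.

Lemma dot_frame y : dot (y *m B) (y *m B) = dot y y.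
Proof. by rewrite -dot_tcoord tcoord_frame. Qed.

(** The square matrix with rows [m] and those of [B] has a right inverse, its
transpose, which is then also a left inverse: the rows are a basis. *)
Lemma dot_decomposition x :
  dot x x = dot (tcoord m B x) (tcoord m B x) + dot x m ^+ 2.
Proof.
have N0 : (0 < N)%N.
  rewrite lt0n; apply/eqP => N0; have := dot_axis.
  rewrite /dot big1 => [/eqP|i _]; first by rewrite eq_sym oner_eq0.
  by move: (ltn_ord i); rewrite {2}N0.
case: N N0 m B hm hB dot_axis axis_mul_frame tcoordE x => [//|n] _ m' B' _ [B1 _] m1 mB tE x.
pose C := col_mx m' B'.
have CC : C *m C^T = 1%:M.
  rewrite /C tr_col_mx mul_col_row B1 mB -(trmxK B') -trmx_mul mB.
  rewrite [RHS](@scalar_mx_block _ 1 n) trmx0; congr block_mx.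
  by apply/matrixP => i j; rewrite !ord1 -dot_mulmx m1 mxE.
have E : m'^T *m m' + B'^T *m B' = 1%:M.
  by rewrite -mul_row_col -tr_col_mx; exact: (@mulmx1C _ n.+1 C C^T CC).
have -> : dot x m' ^+ 2 = (x *m (m'^T *m m') *m x^T) 0 0.
  rewrite mulmxA -mulmxA mxE big_ord1 expr2 -!dot_mulmx; congr (_ * _).
  by rewrite dotC dot_mulmx.
rewrite !dot_mulmx tE trmx_mul trmxK addrC.
transitivity ((x *m (m'^T *m m' + B'^T *m B') *m x^T) 0 0).
  by rewrite E mulmx1.
by rewrite mulmxDr mulmxDl mxE !mulmxA.
Qed.

(** This is half the Laplacian of [|x'|^2]. *)
Lemma sum_dot_tcoord_delta :
  \sum_(i < N) dot (tcoord m B (delta_mx 0 i)) (tcoord m B (delta_mx 0 i)) =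
  N.-1%:R.
Proof.
transitivity (\tr (B *m B^T)); last by rewrite hB.1 mxtrace1.
rewrite /mxtrace /dot exchange_big; apply: eq_bigr => j _.
rewrite mxE; apply: eq_bigr => i _; rewrite !tcoordE -rowE !mxE.
by [].
Qed.

(** The squared length of the gradient of [x . m + c |x'|^2 / 2]: this gradient is
[m + c x'], and the two summands are orthogonal. *)
Lemma sum_sqr_grad_paraboloid (c : R) x :
  \sum_(i < N) (dot (delta_mx 0 i) m +
     c * dot (tcoord m B x) (tcoord m B (delta_mx 0 i))) ^+ 2 =
  1 + c ^+ 2 * dot (tcoord m B x) (tcoord m B x).
Proof.
set y := tcoord m B x; pose v := m + c *: (y *m B).
transitivity (dot v v).
  apply: eq_bigr => i _; rewrite (dotC y) dot_tcoord -dotZr -dotDr -/v.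
  by rewrite dotC dot_delta expr2.
rewrite /v !(dotDl, dotDr, dotZl, dotZr) dot_axis dot_frame (dotC m).
by rewrite dot_frame_axis; ring.
Qed.

Section graph.
Variables (h : 'rV[R]_N.-1 -> R) (x : 'rV[R]_N).
Let y := tcoord m B x.
Hypothesis dh : \forall z \near y, forall i, derivable h z (delta_mx 0 i).
Hypothesis ch : {for y, continuous (grad h)}.

(** The chain rule for the function whose zero set is the graph of [h]. *)
Lemma is_derive_height d :
  is_derive x d (fun z => dot z m - h (tcoord m B z))
    (dot d (m - grad h y *m B)).
Proof.
apply/is_derive_line0/is_derive_expansion => e e0.
have /is_derive_expansion/(_ e e0)[r r0 Hr] := is_derive_grad (tcoord m B d) dh ch.
exists r => // k kr; have := Hr k kr; rewrite -normrN.
congr (`|_| <= _); rewrite add0r -[k *: 1]/(k * 1) mulr1 scale0r addr0.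
rewrite tcoordD tcoordZ -/y dotDl dotZl dotDr dotNr -dot_tcoord.
by rewrite (dotC (grad h y)); ring.
Qed.

Lemma grad_height :
  grad (fun z => dot z m - h (tcoord m B z)) x = m - grad h y *m B.
Proof.
apply/rowP => i; rewrite mxE /partial.
by rewrite (@derive_val _ _ _ _ _ _ _ (is_derive_height _)) dotC dot_delta.
Qed.

End graph.

End frame.

(** * Continuity and compactness in space-time *)

Lemma prod_norm_lt (R : realType) n (p q : 'rV[R]_n * R) (r : R) :
  `|p - q| < r <-> `|p.1 - q.1| < r /\ `|p.2 - q.2| < r.
Proof. by rewrite [`|p - q|]/Num.norm/= gt_max; split=> [/andP|H]; last apply/andP. Qed.

Lemma continuous_sum_ord (R : realType) (T : topologicalType) n
    (g : 'I_n -> T -> R) (x : T) :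
  (forall i, {for x, continuous (g i)}) ->
  {for x, continuous (fun y => \sum_(i < n) g i y)}.
Proof.
move=> cg; elim: (index_enum _) => [|i r IH].
  rewrite (_ : (fun _ => _) = cst 0); first exact: cst_continuous.
  by apply/funext => y; rewrite big_nil.
rewrite (_ : (fun _ => _) = fun y => g i y + \sum_(j <- r) g j y).
  exact: continuousD (cg i) IH.
by apply/funext => y; rewrite big_cons.
Qed.

Lemma continuous_dot (R : realType) (T : topologicalType) n
    (g h : T -> 'rV[R]_n) (x : T) :
  {for x, continuous g} -> {for x, continuous h} ->
  {for x, continuous (fun y => dot (g y) (h y))}.
Proof.
move=> cg ch; apply: continuous_sum_ord => i.
have coord k : {for x, continuous k} -> {for x, continuous (fun y => (k y : 'rV[R]_n) 0 i)}.
  move=> ck; exact: (@cvg_comp _ _ _ k (fun z : 'rV[R]_n => z 0 i) _ _ _ ck (@coord_continuous R 1 n 0 i (k x))).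
by apply: continuousM; exact: coord.
Qed.

Lemma continuous_rV (R : realType) (V : normedModType R) n
    (g : V -> 'rV[R]_n) (x : V) :
  (forall i, {for x, continuous (fun y => g y 0 i)}) -> {for x, continuous g}.
Proof.
move=> cg; apply/cvgrPdist_lt => e e0.
have H : \forall y \near x, forall i, `|g x 0 i - g y 0 i| < e.
  by apply: filter_forall => i; exact: continuous_dist (cg i) _ e0.
near=> y; apply: norm_rV_lt => // i; rewrite !mxE.
by move: i; near: y.
Unshelve. all: by end_near. Qed.

Lemma continuous_tcoord (R : realType) N (m : 'rV[R]_N) (B : 'M[R]_(N.-1, N)) :
  continuous (tcoord m B).
Proof.
move=> x; apply: continuous_rV => i.
have -> : (fun y => tcoord m B y 0 i) = (fun y => dot (Defs.proj m y) (row i B)).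
  by apply/funext => y; rewrite !mxE; apply: eq_bigr => j _; rewrite !mxE.
have cid : {for x, continuous (@id 'rV[R]_N)} by exact: cvg_id.
apply: continuous_dot; last exact: cst_continuous.
apply: (continuousB cid); apply: continuousZl.
by apply: continuous_dot => //; exact: cst_continuous.
Qed.

Lemma continuous_tcoord_fst (R : realType) (N : nat) (m : 'rV[R]_N)
    (B : 'M[R]_(N.-1, N)) :
  continuous (fun p : 'rV[R]_N * R => tcoord m B p.1).
Proof.
move=> p; have cfst : {for p, continuous (@fst 'rV[R]_N R)} by exact: cvg_fst.
exact: (@continuous_comp _ _ _ fst (tcoord m B) p cfst (@continuous_tcoord _ _ m B _)).
Qed.

Lemma compact_bounded_spacetime (R : realType) n (Z : set ('rV[R]_n * R)) (M : R) :
  closed Z -> (forall p, Z p -> `|p.1| <= M /\ `|p.2| <= M) -> compact Z.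
Proof.
move=> cZ bZ.
have c1 : compact [set x : 'rV[R]_n | `|x| <= M].
  apply: bounded_closed_compact.
    exists M; split; first exact: num_real.
    by move=> M' MM' x /= xM; rewrite (le_trans xM)// ltW.
  by apply: (@closed_comp _ _ _ [set r : R | r <= M]) => [x _|]; [exact: norm_continuous|exact: closed_le].
have c2 : compact [set t : R | `|t| <= M].
  rewrite (_ : mkset _ = `[(- M), M]%classic); first exact: segment_compact.
  by apply/seteqP; split=> t /=; rewrite in_itv/= ler_norml.
apply: (subclosed_compact cZ (compact_setX c1 c2)) => p /bZ[p1 p2].
by split.
Qed.

(** A barrier argument looks at the first time at which the barrier is touched;
compactness makes this time exist. *)
Lemma exists_first_time (R : realType) n (Z : set ('rV[R]_n * R)) (M : R) :
  closed Z -> (forall p, Z p -> `|p.1| <= M /\ `|p.2| <= M) -> Z !=set0 ->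
  exists2 p, Z p & forall q, Z q -> p.2 <= q.2.
Proof.
move=> cZ bZ Z0.
have [|p pZ H] := compact_EVT_min Z0 (compact_bounded_spacetime cZ bZ) (f := snd).
  by apply: continuous_subspaceT => p; exact: cvg_snd.
by exists p; [exact: set_mem|move=> q /mem_set; exact: H].
Qed.

(** * The profile and the parameters of the barrier *)

(** Concave, with slope [b] at 0 and increasing up to [b / (2 g)]. *)
Definition profile (R : realType) (b g z : R) : R := b * z - g * z ^+ 2.

Lemma is_derive_profile (R : realType) (b g x l : R) (q : R -> R) :
  is_derive x 1 q l ->
  is_derive x 1 (fun k => profile b g (q k)) ((b - 2 * g * q x) * l).
Proof.
move=> dq.
have dc (c : R) : is_derive x 1 (fun=> c) 0 by exact: is_derive_cst.
have H : is_derive x 1 (fun k => profile b g (q k)) _ :=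
  is_derive_fun_sub (is_derive_fun_mul (dc b) dq)
    (is_derive_fun_mul (dc g) (is_derive_fun_mul dq dq)).
by apply: is_derive_eq H _; ring.
Qed.

(** The second derivative of the profile along a line on which its argument is
quadratic. *)
Lemma is_derive_profile_slope (R : realType) (b g a c d x : R) :
  is_derive x 1
    (fun k : R => (b - 2 * g * (a + c * k + d * k ^+ 2)) * (c + 2 * d * k))
    ((b - 2 * g * (a + c * x + d * x ^+ 2)) * (2 * d)
      - 2 * g * (c + 2 * d * x) ^+ 2).
Proof.
have dc (e : R) : is_derive x 1 (fun=> e) 0 by exact: is_derive_cst.
have dlin : is_derive x 1 (fun k : R => c + 2 * d * k) (2 * d).
  have H := is_derive_quadratic c (2 * d) 0 x.
  have -> : (fun k => c + 2 * d * k) = (fun k : R => c + 2 * d * k + 0 * k ^+ 2).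
    by apply/funext => k; ring.
  by apply: is_derive_eq H _; ring.
have H := is_derive_fun_mul (is_derive_fun_sub (dc b)
  (is_derive_fun_mul (dc (2 * g)) (is_derive_quadratic a c d x))) dlin.
by apply: is_derive_eq; ring.
Qed.

Lemma profile_gt0 (R : realType) (b g z : R) :
  0 < g -> 0 < z -> 2 * g * z <= b -> 0 < profile b g z.
Proof.
move=> g0 z0 zb; rewrite /profile expr2 mulrA -mulrBl mulr_gt0// subr_gt0.
by have := mulr_gt0 g0 z0; lra.
Qed.

Lemma profile_le0 (R : realType) (b g z : R) :
  0 <= b -> 0 <= g -> z <= 0 -> profile b g z <= 0.
Proof.
move=> b0 g0 z0; rewrite /profile subr_le0 (@le_trans _ _ 0)//.
  by rewrite mulr_ge0_le0.
by rewrite mulr_ge0// sqr_ge0.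
Qed.

(** The order of the choices matters: [b] fixes the slope of the barrier below
[alpha], [w] is small with respect to [b / M], and only then [r], the time up to
which the free boundary stays within [w] of its initial position, is known.  The
final time [t0] determines the speed [c], then the curvature [g], which makes the
barrier a supersolution, and the thickness [dl] of the layer up to the vertex of
the profile.  With [2 g dl = b] the last claim reads [4 g M t0 < b^2]; the terms
of [2 g] without [c] contribute a multiple of [t0], and [b c] contributes
[8 M b w]. *)
Lemma barrier_parameters (R : realType) (alpha K L M T : R) :
  0 < alpha -> 0 <= K -> 0 <= L -> 1 <= M -> 0 < T ->
  exists b w : R, [/\ 0 < b, b * (1 + 3 * K) = alpha / 2, 0 < w <= 1 / 10 &
    forall r : R, 0 < r -> exists t0 c g dl : R,
      [/\ [/\ 0 < t0, t0 < r & t0 < T], 0 < c /\ c * t0 = 4 * w,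
          0 < g /\ 2 * g = M + b * (c + 2 * L),
          0 < dl <= 1 / 4 /\ 2 * g * dl = b & M * t0 < profile b g dl]].
Proof.
move=> a0 K0 L0 M1 T0.
have M0 : 0 < M by exact: lt_le_trans M1.
have K3 : 0 < 1 + 3 * K by lra.
have [b [b0 bK]] : exists b : R, 0 < b /\ b * (1 + 3 * K) = alpha / 2.
  exists (alpha / 2 / (1 + 3 * K)); split; last by rewrite divfK ?gt_eqF.
  by rewrite divr_gt0// divr_gt0.
have [w [w0 w10 wb]] : exists w : R, [/\ 0 < w, w <= 1 / 10 & 16 * M * w <= b].
  exists (Num.min (1 / 10) (b / (16 * M))).
  split; first by rewrite lt_min !divr_gt0 ?mulr_gt0.
    by rewrite ge_min lexx.
  rewrite [leLHS]mulrC -ler_pdivlMr; last by rewrite mulr_gt0.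
  by rewrite ge_min lexx orbT.
exists b, w; split=> //; first by rewrite w0.
move=> r r0; have bL : 0 <= b * L by rewrite mulr_ge0// ltW.
pose F := 4 * M * (M + 2 * (b * L)).
have F0 : 0 < F by apply: mulr_gt0; lra.
have [t0 [t00 t0r t0T t0w t0F]] : exists t0 : R,
    [/\ 0 < t0, t0 < r, t0 < T, t0 < w & t0 * F < b ^+ 2].
  pose e := Num.min (Num.min r T) (Num.min w (b ^+ 2 / F)).
  have e0 : 0 < e by rewrite !lt_min r0 T0 w0 divr_gt0// exprn_gt0.
  exists (e / 2); have : e / 2 < e by rewrite ltr_pdivrMr// ltr_pMr// ltr1n.
  rewrite {2}/e !lt_min ltr_pdivlMr// => /andP[/andP[? ?] /andP[? ?]].
  by split=> //; rewrite divr_gt0.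
have [c ct0] : exists c, c * t0 = 4 * w.
  by exists (4 * w / t0); rewrite divfK// gt_eqF.
have c4 : 4 <= c by rewrite -(ler_pM2r t00) ct0; lra.
have bc : b * 4 <= b * c by rewrite ler_pM2l.
have [g g2] : exists g, 2 * g = M + b * (c + 2 * L).
  by exists ((M + b * (c + 2 * L)) / 2); field.
have g0 : 0 < g by lra.
have [dl gdl] : exists dl, 2 * g * dl = b.
  by exists (b / (2 * g)); field; rewrite gt_eqF.
have dl0 : 0 < dl by rewrite -(pmulr_rgt0 _ g0); lra.
have dl4 : dl <= 1 / 4 by rewrite -(ler_pM2l g0); lra.
exists t0, c, g, dl; split=> //; [by split=> //; lra|by rewrite dl0|].
have -> : profile b g dl = g * dl ^+ 2 by rewrite /profile -gdl; ring.
rewrite -(ltr_pM2l g0).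
have : 4 * g * M * t0 < b ^+ 2.
  have -> : 4 * g * M * t0 = t0 * F / 2 + 2 * M * b * (c * t0).
    have -> : 4 * g * M * t0 = 2 * (2 * g) * M * t0 by ring.
    by rewrite g2 /F; field.
  have := ler_wpM2l (ltW b0) wb.
  by rewrite ct0 expr2; lra.
rewrite -gdl.
have -> : (2 * g * dl) ^+ 2 = 4 * (g * (g * dl ^+ 2)) by ring.
by lra.
Qed.

(** Minimise [h y + K |y|^2] over the unit ball, with [K] so large that the values
on the sphere exceed the value [h 0] at the centre by at least 1. *)
Lemma paraboloid_touching_inside (R : realType) n (h : 'rV[R]_n -> R) :
  continuous h -> exists (K c : R) (y0 : 'rV[R]_n),
  [/\ 0 <= K, dot y0 y0 <= 1, h y0 + K * dot y0 y0 = c,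
      forall y, dot y y <= 1 -> c <= h y + K * dot y y &
      forall y, dot y y = 1 -> c + 1 <= h y + K * dot y y].
Proof.
move=> ch; pose ball1 : set 'rV[R]_n := [set y | dot y y <= 1].
have cid (y : 'rV[R]_n) : {for y, continuous (@id 'rV[R]_n)} by exact: cvg_id.
have cdot : continuous (fun y : 'rV[R]_n => dot y y).
  by move=> y; exact: continuous_dot.
have cball : compact ball1.
  apply: bounded_closed_compact.
    exists 2; split; first exact: num_real.
    by move=> r r2 y /= /norm_le_dot yr; rewrite (le_trans yr)// ltW.
  by apply: (@closed_comp _ _ _ [set r : R | r <= 1]) => [y _|]; [exact: cdot|exact: closed_le].
have ball0 : ball1 0 by rewrite /ball1/= dot0l.
have ne : ball1 !=set0 by exists 0.
have [z _ Hz] := compact_EVT_min ne cball (continuous_subspaceT ch).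
pose K := h 0 + 1 - h z.
have K0 : 0 <= K by rewrite /K; have := Hz 0 (mem_set ball0); lra.
have cg : continuous (fun y => h y + K * dot y y).
  move=> y; have cK : {for y, continuous (fun=> K)} by exact: cst_continuous.
  exact: (continuousD (ch y) (continuousM cK (cdot y))).
have [y0 /set_mem y01 Hy0] := compact_EVT_min ne cball (continuous_subspaceT cg).
exists K, (h y0 + K * dot y0 y0), y0; split=> // y y1.
  exact: Hy0 (mem_set y1).
have := Hy0 0 (mem_set ball0); rewrite dot0l mulr0 addr0 => c0.
have := Hz y (mem_set (_ : ball1 y)); rewrite /ball1/= y1 => /(_ (lexx _)).
by rewrite /K in c0 *; lra.
Qed.

(** * The space-time region of a solution *)

(** Moving a point of the graph along the axis leads into the epigraph or out of it,
depending on the direction. *)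
Lemma epigraph_boundary (R : realType) (N : nat) (m : 'rV[R]_N)
    (B : 'M[R]_(N.-1, N)) (h : 'rV[R]_N.-1 -> R) (x : 'rV[R]_N) :
  enorm m = 1 -> hyperplane_frame m B ->
  h (tcoord m B x) = dot x m -> boundary (epigraph m B h) x.
Proof.
move=> hm hB hx.
have shift (r : R) k : 0 < r -> `|k| <= r / (`|m| + 1) -> `|x - (x + k *: m)| <= r.
  move=> r0 kr; rewrite opprD addrA subrr sub0r normrN normrZ.
  have m0 : 0 < `|m| + 1 by rewrite ltr_wpDl.
  rewrite (le_trans (ler_wpM2r _ kr))// mulrAC ler_pdivrMr// ler_wpM2l ?(ltW r0)//.
  by rewrite lerDl.
have eqm k : epigraph m B h (x + k *: m) <-> 0 < k.
  rewrite /epigraph/= tcoordD// tcoordZ// tcoord_axis// scaler0 addr0 hx.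
  by rewrite dotDl dotZl dot_axis// mulr1 ltrDl.
split.
  move=> A /nbhs_normP[r /= r0 rA].
  pose k := r / 2 / (`|m| + 1).
  have r20 : 0 < r / 2 by rewrite divr_gt0.
  have k0 : 0 < k by rewrite divr_gt0// ltr_wpDl.
  exists (x + k *: m); split; first by apply/eqm.
  apply: rA => /=; rewrite (le_lt_trans (shift _ _ r20 _)) ?gtr0_norm//.
  by rewrite ltr_pdivrMr// ltr_pMr// ltr1n.
move=> /nbhs_normP[r /= r0 rA].
pose k := r / 2 / (`|m| + 1).
have r20 : 0 < r / 2 by rewrite divr_gt0.
have k0 : 0 < k by rewrite divr_gt0// ltr_wpDl.
have : epigraph m B h (x + - k *: m).
  apply: rA => /=; rewrite (le_lt_trans (shift _ _ r20 _)) ?normrN ?gtr0_norm//.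
  by rewrite ltr_pdivrMr// ltr_pMr// ltr1n.
by move/eqm; rewrite oppr_gt0 ltNge (ltW k0).
Qed.

Section solution.
Context (R : realType) (N : nat) (alpha T : R) (f : 'rV[R]_N -> R -> R).
Context (m : 'rV[R]_N) (B : 'M[R]_(N.-1, N)) (s0 : 'rV[R]_N.-1 -> R).
Context (u : 'rV[R]_N -> R -> R) (s : 'rV[R]_N.-1 -> R -> R).
Hypotheses (hT : 0 < T) (hm : enorm m = 1) (hB : hyperplane_frame m B).
Hypothesis cs0 : continuous s0.
Hypothesis sol : initial_value_solution m B T alpha f (fun _ => 0) s0 u s.
Implicit Types p q : 'rV[R]_N * R.

Let Q : set ('rV[R]_N * R) := QT T (moving_domain m B s).
Let csol := ivs_solution sol.

(** Extended by the initial position to negative times, the height is continuous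
up to the initial time in the ordinary sense, without one-sided limits. *)
Definition height (y : 'rV[R]_N.-1) (t : R) : R := if t <= 0 then s0 y else s y t.

(** The union of [Q_T], [S_T] and the closure of the initial domain. *)
Definition region : set ('rV[R]_N * R) :=
  [set p | 0 <= p.2 < T /\ height (tcoord m B p.1) p.2 <= dot p.1 m].

Lemma height_s y t : 0 < t -> height y t = s y t.
Proof. by move=> t0; rewrite /height leNgt t0. Qed.

Lemma height_near_initial (e : R) : 0 < e ->
  exists2 r : R, 0 < r & forall t y, 0 <= t < r -> `|height y t - s0 y| < e.
Proof.
move=> e0; have := ivs_s_init sol e0.
rewrite near_withinE => /near_norm[r r0 Hr].
exists r => // t y /andP[]; rewrite le_eqVlt => /predU1P[<-|t0] tr.
  by rewrite /height lexx subrr normr0.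
by have [] := Hr t _ t0 y; rewrite ?height_s// sub0r normrN gtr0_norm.
Qed.

Lemma slab_open p : 0 < p.2 < T -> \forall q \near p, 0 < q.2 < T.
Proof.
move=> /andP[p0 pT].
have c : {for p, continuous (@snd 'rV[R]_N R)} by exact: cvg_snd.
have h : (0 : R) < Num.min p.2 (T - p.2) by rewrite lt_min p0 subr_gt0.
apply: filterS (continuous_dist c h) => q.
by rewrite lt_min !ltr_norml; lra.
Qed.

Lemma height_continuous (y : 'rV[R]_N.-1) (t : R) : t < T ->
  {for (y, t), continuous (fun z : 'rV[R]_N.-1 * R => height z.1 z.2)}.
Proof.
move=> tT.
have csnd : {for (y, t), continuous (@snd 'rV[R]_N.-1 R)} by exact: cvg_snd.
have cfst : {for (y, t), continuous (fun p : 'rV[R]_N.-1 * R => s0 p.1)}.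
  by apply: (@continuous_comp _ _ _ fst s0); [exact: cvg_fst|exact: cs0].
apply/cvgrPdist_lt => e e0 /=.
have [t0|t0|t0] := ltgtP t 0.
- have nt0 : 0 < - t by rewrite oppr_gt0.
  apply: filterS (filterI (continuous_dist csnd nt0) (continuous_dist cfst e0)) => -[y' t'] [/= tt' yy'].
  by rewrite /height (ltW t0) ifT//; move: tt'; rewrite ltr_norml; lra.
- have cs : {within [set p : 'rV[R]_N.-1 * R | 0 < p.2 < T],
      continuous (fun z : 'rV[R]_N.-1 * R => s z.1 z.2)} := C21_cont (sol_s_reg csol).
  have tT0 : 0 < t < T by rewrite t0.
  have tT1 : 0 < Num.min t (T - t) by rewrite lt_min t0 subr_gt0.
  have csy := within_continuous_dist cs
     (tT0 : [set p : 'rV[R]_N.-1 * R | 0 < p.2 < T] (y, t)) e0.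
  apply: filterS (filterI (continuous_dist csnd tT1) csy) => -[y' t'] [/= tt' yy'].
  have t'0 : 0 < t' < T by move: tt'; rewrite lt_min !ltr_norml; lra.
  by rewrite !height_s//; [exact: yy'|case/andP: t'0].
- move: t0 tT csnd cfst => -> tT csnd cfst.
  have h0 : height y 0 = s0 y by rewrite /height lexx.
  have e20 : 0 < e / 2 by rewrite divr_gt0.
  have [r r0 Hr] := height_near_initial e20.
  apply: filterS (filterI (continuous_dist csnd r0) (continuous_dist cfst e20)).
  move=> -[y' t'] [/=]; rewrite sub0r normrN ltr_norml => /andP[_ t'r] yy'; rewrite h0.
  have [t'0|t'0] := leP t' 0; first by rewrite /height t'0 (lt_trans yy')//; lra.
  have := Hr t' y'; rewrite (ltW t'0) t'r => /(_ isT).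
  by move: yy'; rewrite !ltr_norml; lra.
Qed.

Lemma gap_continuous p : p.2 < T ->
  {for p, continuous (fun q => dot q.1 m - height (tcoord m B q.1) q.2)}.
Proof.
move=> pT.
have c1 : {for p, continuous (fun q => dot q.1 m)}.
  by apply: continuous_dot; [exact: cvg_fst|exact: cst_continuous].
have c2 : (tcoord m B q.1, q.2) @[q --> p] --> (tcoord m B p.1, p.2).
  have c3 : q.2 @[q --> p] --> p.2 by exact: cvg_snd.
  exact: (cvg_pair (@continuous_tcoord_fst _ _ m B p) c3).
apply: (continuousB c1).
exact: (cvg_comp _ _ c2 (height_continuous (y := tcoord m B p.1) pT)).
Qed.

Lemma region_inside p : 0 < p.2 -> region p ->
  height (tcoord m B p.1) p.2 < dot p.1 m -> Q p.
Proof.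
move=> p0 [/andP[_ pT] _] pm; split; first by rewrite p0.
by move: pm; rewrite height_s.
Qed.

Lemma region_boundary p : 0 < p.2 -> region p ->
  height (tcoord m B p.1) p.2 = dot p.1 m -> ST T (moving_domain m B s) p.
Proof.
move=> p0 [/andP[_ pT] _]; rewrite height_s// => pm.
by split; [rewrite p0|exact: epigraph_boundary].
Qed.

Lemma region_cases p : region p ->
  [\/ p.2 = 0, Q p | [/\ 0 < p.2, ST T (moving_domain m B s) p &
       height (tcoord m B p.1) p.2 = dot p.1 m]].
Proof.
move=> Fp; have [/andP[+ pT] pm] := Fp; rewrite le_eqVlt => /predU1P[<-|p0].
  exact: Or31.
move: pm; rewrite le_eqVlt => /predU1P[pm|pm]; last first.
  by apply: Or32; exact: region_inside.
by apply: Or33; split => //; exact: region_boundary.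
Qed.

Lemma initial_closure x : s0 (tcoord m B x) <= dot x m ->
  closure (epigraph m B s0) x.
Proof.
rewrite le_eqVlt => /predU1P[E|E]; first by case: (epigraph_boundary hm hB E).
exact: subset_closure.
Qed.

Lemma u_continuous : {within region, continuous (fun p => u p.1 p.2)}.
Proof.
apply: continuous_subspaceW (ivs_u_cont sol) => p Fp.
have [p0|Qp|[_ Sp _]] := region_cases Fp; [right|by left; left|by left; right].
split => //=; apply: initial_closure; have [_] := Fp.
by rewrite /height p0 lexx.
Qed.

Lemma u_initial p : region p -> p.2 = 0 -> u p.1 p.2 = 0.
Proof.
move=> [_ +] p0; rewrite /height p0 lexx => H.
exact: (ivs_u_init sol (initial_closure H)).
Qed.

Lemma u_ge0 p : region p -> 0 <= u p.1 p.2.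
Proof.
move=> Fp; have [p0|Qp|[_ Sp _]] := region_cases Fp.
- by rewrite u_initial.
- exact: (sol_u_ge0 csol Qp).
- by rewrite (sol_dirichlet csol Sp).
Qed.

Lemma Q_region : Q `<=` region.
Proof.
move=> p [/andP[p0 pT] H]; split; first by rewrite ltW.
by rewrite height_s// ltW.
Qed.

Lemma Q_open p : Q p -> \forall q \near p, Q q.
Proof.
move=> [/[dup] pT /andP[p0 pT'] H].
have g0 : 0 < dot p.1 m - height (tcoord m B p.1) p.2.
  by rewrite height_s// subr_gt0.
apply: filterS2 (slab_open pT) (continuous_dist (gap_continuous pT') g0).
move=> q /[dup] qT /andP[q0 _]; rewrite (height_s _ q0) => H'; split => //.
by rewrite /moving_domain/epigraph/= -subr_gt0; move: H'; rewrite ltr_norml; lra.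
Qed.

Lemma u_continuous_inside p : Q p -> {for p, continuous (fun q => u q.1 q.2)}.
Proof.
move=> Qp; apply/cvgrPdist_lt => e e0.
have := within_continuous_dist u_continuous (Q_region Qp) e0.
by apply: filterS2 (Q_open Qp) => q Qq; apply; exact: Q_region.
Qed.

(** [t0 < T] is essential, since nothing is known of the solution at time [T]. *)
Lemma contact_closed (A : set ('rV[R]_N * R)) (V : 'rV[R]_N -> R -> R) (t0 : R) :
  t0 < T -> closed A -> continuous (fun p => V p.1 p.2) ->
  closed (region `&` [set p | p.2 <= t0] `&` A `&`
          [set p | V p.1 p.2 <= u p.1 p.2]).
Proof.
move=> t0T cA cV p clp.
have np P : (\forall q \near p, P q) ->
    exists q, [/\ region q, q.2 <= t0, A q, V q.1 q.2 <= u q.1 q.2 & P q].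
  by move=> /clp[q [[[[Fq qt] Aq] Vq] Pq]]; exists q.
have csnd : {for p, continuous (@snd 'rV[R]_N R)} by exact: cvg_snd.
have pt0 : p.2 <= t0.
  rewrite leNgt; apply/negP; rewrite -subr_gt0 => h.
  have [q [_ qt _ _]] := np _ (continuous_dist csnd h).
  by rewrite ltr_norml; lra.
have p0 : 0 <= p.2.
  rewrite leNgt; apply/negP; rewrite -oppr_gt0 => h.
  have [q [[/andP[q0 _] _] _ _ _]] := np _ (continuous_dist csnd h).
  by rewrite ltr_norml; lra.
have pT : p.2 < T by exact: le_lt_trans t0T.
have Fp : region p.
  split; first by rewrite p0.
  rewrite leNgt; apply/negP; rewrite -subr_lt0 -oppr_gt0 => h.
  have [q [[_ Fq] _ _ _]] := np _ (continuous_dist (gap_continuous pT) h).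
  by rewrite ltr_norml; lra.
split=> /=.
  split=> //; apply: cA => P /np[q [_ _ Aq _ Pq]]; by exists q.
rewrite leNgt; apply/negP; rewrite -subr_gt0 => h.
have h2 : 0 < (V p.1 p.2 - u p.1 p.2) / 2 by rewrite divr_gt0.
have [q [Fq _ _ Vq [/= /(_ Fq)]]] := np _ (filterI
  (within_continuous_dist u_continuous Fp h2) (continuous_dist (cV p) h2)).
by rewrite !ltr_norml; lra.
Qed.

(** * First contact with a barrier *)

(** At the contact time the strict inequality survives as a weak one. *)
Lemma contact_slice (V : 'rV[R]_N -> R -> R) q :
  {for q, continuous (fun z => u z.1 z.2)} -> {for q, continuous (fun z => V z.1 z.2)} ->
  (\forall z \near q, z.2 < q.2 -> u z.1 z.2 < V z.1 z.2) ->
  u q.1 q.2 <= V q.1 q.2.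
Proof.
move=> cu cV before; rewrite leNgt; apply/negP; rewrite -subr_gt0 => h.
have h2 : 0 < (u q.1 q.2 - V q.1 q.2) / 2 by rewrite divr_gt0.
have [r r0 Hr] := near_norm (filterI before
  (filterI (continuous_dist cu h2) (continuous_dist cV h2))).
have r20 : 0 < r / 2 by rewrite divr_gt0.
have [|/(_ _)/=] := Hr (q.1, q.2 - r / 2).
  apply/prod_norm_lt; rewrite /= subrr normr0 opprB addrC subrK gtr0_norm//.
  by split => //; rewrite ltr_pdivrMr// ltr_pMr// ltr1n.
rewrite ltrBlDr ltrDl => /(_ r20) uV [].
by rewrite !ltr_norml; lra.
Qed.

(** At a first contact [u - V] has a maximum in space, and its time derivative is
nonnegative: so [u_t - Lap u >= V_t - Lap V].  The functions [V1 i] and the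
numbers [V2 i] are the first and second derivatives of [V] along the i-th axis. *)
Lemma interior_contact (V : 'rV[R]_N -> R -> R) p (V1 : 'I_N -> R -> R)
    (V2 : 'I_N -> R) (Vt : R) :
  Q p -> continuous (fun z => V z.1 z.2) ->
  (forall i h, is_derive (h : R) 1 (fun k => V (p.1 + k *: delta_mx 0 i) p.2) (V1 i h)) ->
  (forall i, is_derive (0 : R) 1 (V1 i) (V2 i)) ->
  is_derive p.2 1 (V p.1) Vt ->
  V p.1 p.2 <= u p.1 p.2 ->
  (\forall q \near p, q.2 < p.2 -> u q.1 q.2 < V q.1 q.2) ->
  Vt - \sum_(i < N) V2 i <= f p.1 p.2.
Proof.
move=> Qp cV dV1 dV2 dVt Vu before.
have after : \forall q \near p, Q q /\ (p.2 = q.2 -> u q.1 q.2 <= V q.1 q.2).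
  apply: filterS2 (Q_open Qp) (near_join before) => q Qq bq; split=> // pq.
  apply: contact_slice; [exact: u_continuous_inside|exact: cV|].
  by move: bq; rewrite pq.
have up : u p.1 p.2 = V p.1 p.2.
  by apply/eqP; rewrite eq_le Vu andbT; have [_] := nbhs_singleton after; apply.
have cline (v : 'rV[R]_N) (P : set ('rV[R]_N * R)) : (\forall q \near p, P q) ->
    \forall h \near (0 : R), P (p.1 + h *: v, p.2).
  move=> /near_norm[r r0 Hr].
  have v0 : 0 < `|v| + 1 by rewrite ltr_wpDl.
  apply: (@near_intro _ _ _ _ (r / (`|v| + 1))); first by rewrite divr_gt0.
  move=> h; rewrite sub0r normrN ltr_pdivlMr// => hr.
  apply/Hr/prod_norm_lt; rewrite /= subrr normr0; split => //.
  rewrite opprD addrA subrr sub0r normrN normrZ (le_lt_trans _ hr)//.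
  by rewrite ler_wpM2l// lerDl.
have time : Vt <= derive1 (u p.1) p.2.
  have dut : is_derive p.2 1 (u p.1) (derive1 (u p.1) p.2).
    by rewrite derive1E; apply: derivableP; exact: C21_time (sol_u_reg csol) _ Qp.
  rewrite -subr_ge0.
  apply: (@derivative_ge0_of_left_max _ (fun t => u p.1 t - V p.1 t) p.2).
  have [r r0 Hr] := near_norm before.
  apply: (near_intro r0) => t tr tp; rewrite up subrr subr_le0 ltW//.
  by apply: (Hr (p.1, t)) => //; apply/prod_norm_lt; rewrite /= subrr normr0.
have space i : partial i (partial i (u^~ p.2)) p.1 <= V2 i.
  rewrite -subr_le0.
  apply: (@second_derivative_at_max _
    (fun h => u (p.1 + h *: delta_mx 0 i) p.2 - V (p.1 + h *: delta_mx 0 i) p.2)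
    (fun h => partial i (u^~ p.2) (p.1 + h *: delta_mx 0 i) - V1 i h)).
  - apply: filterS (cline (delta_mx 0 i) _ (Q_open Qp)) => h Qh.
    have [/(_ i) du _] := C21_space (sol_u_reg csol) Qh.
    exact: is_derive_fun_sub (is_derive_line (derivableP du)) (dV1 i h).
  - have [_ /(_ i i) ddu] := C21_space (sol_u_reg csol) Qp.
    have line := (is_derive_line0 _ _ _ _).1 (derivableP ddu).
    exact: is_derive_fun_sub line (dV2 i).
  - apply: filterS (cline (delta_mx 0 i) _ after) => h [_ /(_ erefl)/= uV].
    by rewrite scale0r addr0 up subrr subr_le0.
rewrite -(sol_eq csol Qp) lerB//.
by apply: ler_sum => i _; exact: space.
Qed.

(** Along the inward normal [d], [u] grows from 0 with slope [alpha], and [V] stays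
above [u].  The segment from [p] in the direction of [d] runs inside the domain
because the height function [x . m - s(t,x')] grows along its own gradient; the
slope of [u] on it is found with the mean value theorem, from the continuity of
the extended gradient at [p]. *)
Lemma boundary_contact (V : 'rV[R]_N -> R -> R) p :
  0 < p.2 -> region p -> height (tcoord m B p.1) p.2 = dot p.1 m ->
  continuous (fun z => V z.1 z.2) ->
  (\forall q \near p, Q q -> q.2 < p.2 -> u q.1 q.2 < V q.1 q.2) ->
  exists2 d, dot d d = 1 & forall e : R, 0 < e -> exists2 r : R, 0 < r &
    forall h : R, 0 < h < r -> (alpha - e) * h <= V (p.1 + h *: d) p.2.
Proof.
move=> p0 Fp pm cV before.
have Sp := region_boundary p0 Fp pm.
have [/andP[_ pT] _] := Fp.
have p0T : 0 < p.2 < T by rewrite p0.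
set y := tcoord m B p.1 in pm; set t := p.2.
have sreg := sol_s_reg csol.
have slab z : [set z : 'rV[R]_N.-1 * R | 0 < z.2 < T] (z, t) by [].
have ds : \forall z \near y, forall i, derivable (s^~ t) z (delta_mx 0 i).
  by apply: (near_intro ltr01) => z _ i; have [H _] := C21_space sreg (slab z); exact: H.
have cs : {for y, continuous (grad (s^~ t))}.
  apply: continuous_of_dist => e e0.
  have [r r0 Hr] := near_norm (within_continuous_dist (C21_grad sreg) (slab y) e0).
  exists r => // z zr; apply: (Hr (z, t)) => //.
  by apply/prod_norm_lt; rewrite /= subrr normr0.
pose w := m - grad (s^~ t) y *m B.
have ww : dot w w = 1 + dot (grad (s^~ t) y) (grad (s^~ t) y).
  rewrite /w !(dotDl, dotDr, dotNl, dotNr) dot_axis// (dot_frame hB) (dotC m).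
  by rewrite (dot_frame_axis hB); ring.
have n0 : 0 < enorm w by rewrite sqrtr_gt0 ww ltr_wpDr ?dot_ge0.
have nn : enorm w * enorm w = dot w w by rewrite -expr2 sqr_sqrtr ?dot_ge0.
pose d := (enorm w)^-1 *: w.
have dd : dot d d = 1.
  by rewrite /d dotZl dotZr -nn mulKf ?mulVf ?gt_eqF.
have dw : dot d w = enorm w by rewrite /d dotZl -nn mulKf ?gt_eqF.
exists d => // e e0.
have [G [cG GQ GS]] := sol_neumann csol.
have Gd : dot (G p) d = alpha.
  have := GS p Sp; rewrite /exterior_normal /= (grad_height hB ds cs).
  rewrite -/y -/w scaleNr dotNr.
  exact: oppr_inj.
have e20 : 0 < e / 2 by rewrite divr_gt0.
have cGd : {within Q `|` ST T (moving_domain m B s), continuous (fun q => dot (G q) d)}.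
  move=> q; apply: (@continuous_dot R (subspace (Q `|` ST T (moving_domain m B s))) N
    G (fun _ => d) q (cG q)); exact: cst_continuous.
(* The extended gradient is close to its value at p, and V is above u before the
   contact time, near every point close to p. *)
have [r1 r10 Hr1] := near_norm (filterI (near_join before)
  (within_continuous_dist cGd (or_intror Sp : (Q `|` _) p) e0)).
have /is_derive_expansion := is_derive_height hB ds cs d.
have n20 : 0 < enorm w / 2 by rewrite divr_gt0.
move=> /(_ _ n20)[r2 r20 Hr2]; rewrite -/w dw in Hr2.
have v0 : 0 < `|d| + 1 by rewrite ltr_wpDl.
pose r := Num.min (r1 / (`|d| + 1)) r2.
have inQ h : 0 < h < r -> Q (p.1 + h *: d, t).
  move=> /andP[h0]; rewrite lt_min => /andP[_ hr2].
  split => //=; rewrite /moving_domain/epigraph/= -subr_gt0.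
  have := Hr2 h; rewrite (gtr0_norm h0) => /(_ hr2).
  rewrite -/y -pm height_s// subrr subr0 ler_norml => /andP[+ _].
  by have := mulr_gt0 h0 n0; lra.
have close h : 0 < h < r -> `|p - (p.1 + h *: d, t)| < r1.
  move=> /andP[h0]; rewrite lt_min ltr_pdivlMr// => /andP[hr1 _].
  apply/prod_norm_lt; rewrite /= subrr normr0; split => //.
  rewrite opprD addrA subrr sub0r normrN normrZ gtr0_norm// (le_lt_trans _ hr1)//.
  by rewrite ler_wpM2l ?(ltW h0)// lerDl.
exists r; first by rewrite lt_min r20 divr_gt0.
move=> h hr; have [h0 _] := andP hr.
have uV : u (p.1 + h *: d) t <= V (p.1 + h *: d) t.
  have [bq _] := Hr1 _ (close h hr).
  apply: (@contact_slice V (p.1 + h *: d, t)).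
  - exact: u_continuous_inside (inQ h hr).
  - exact: cV.
  - by apply: filterS2 bq (Q_open (inQ h hr)) => z bz Qz; exact: bz.
apply: le_trans uV.
pose v k := u (p.1 + k *: d) t.
have kr k : 0 < k <= h -> 0 < k < r.
  by move=> /andP[-> kh]; have /andP[_] := hr; exact: le_lt_trans.
have dv k : k \in `]0, h[ -> is_derive k 1 v (dot (grad (u^~ t) (p.1 + k *: d)) d).
  rewrite in_itv/= => /andP[k0 kh]; have Qk := inQ k (kr k _).
  have {}Qk : Q (p.1 + k *: d, t) by apply: Qk; rewrite k0 ltW.
  apply: (is_derive_line (f := u^~ t)); apply: is_derive_grad.
    have [q q0 Hq] := near_norm (Q_open Qk).
    apply: (near_intro q0) => z zq i.
    have Qz : Q (z, t) by apply: Hq; apply/prod_norm_lt; rewrite /= subrr normr0.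
    by have [H _] := C21_space (sol_u_reg csol) Qz; exact: H.
  apply: continuous_of_dist => e' e'0.
  have [q q0 Hq] := near_norm (filterI (Q_open Qk)
     (within_continuous_dist (C21_grad (sol_u_reg csol)) Qk e'0)).
  exists q => // z zq.
  have zq' : `|(p.1 + k *: d, t) - (z, t)| < q.
    by apply/prod_norm_lt; rewrite /= subrr normr0.
  by have [Qz] := Hq _ zq'; exact.
have cv : {within `[0, h], continuous v}.
  apply/subspace_continuousP => k; rewrite /= in_itv/= => /andP[k0 kh].
  have Fk k' : 0 <= k' <= h -> region (p.1 + k' *: d, t).
    rewrite le_eqVlt => /andP[/predU1P[<-|k'0] k'h].
      by rewrite scale0r addr0 /t -surjective_pairing.
    by apply/Q_region/inQ/kr; rewrite k'0.
  apply/cvgrPdist_lt => e' e'0; rewrite near_withinE.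
  have Fk0 : region (p.1 + k *: d, t) by apply: Fk; rewrite k0.
  have [q q0 Hq] := near_norm (within_continuous_dist u_continuous Fk0 e'0).
  apply/nbhs_normP; exists (q / (`|d| + 1)); first by rewrite /= divr_gt0.
  move=> k'; rewrite /= ltr_pdivlMr// => kk'; rewrite in_itv/= => k'h.
  apply: (Hq (p.1 + k' *: d, t)); last exact: Fk.
  apply/prod_norm_lt; rewrite /= subrr normr0; split => //.
  rewrite opprD addrACA subrr add0r -scalerBl normrZ (le_lt_trans _ kk')//.
  by rewrite ler_wpM2l// lerDl.
have [k] := MVT h0 dv cv; rewrite in_itv/= => /andP[k0 kh].
rewrite /v scale0r addr0 (sol_dirichlet csol Sp) !subr0 => ->.
rewrite ler_pM2r//.
have kr' : 0 < k < r by apply: kr; rewrite k0 ltW.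
have Qk := inQ k kr'.
have [_ /(_ (or_introl Qk))] := Hr1 _ (close k kr').
by rewrite Gd (GQ _ Qk) /= ltr_norml; lra.
Qed.

(** * The maximum principle *)

(** The multiple [k (1 + |x|^2 + 2 N t)], which solves the heat equation and is large
far away, makes the contact set compact, since [u] is bounded; then [k] tends to
0. *)
Lemma u_le_linear (M : R) p :
  (forall x t, 0 < t < T -> f x t <= M) -> region p ->
  u p.1 p.2 <= (`|M| + 1) * p.2.
Proof.
move=> fM Fp; have [/andP[p0 pT] _] := Fp.
have [Mu0 uM0] := ivs_u_bounded sol; pose Mu := `|Mu0|.
have uM q : region q -> u q.1 q.2 <= Mu.
  move=> Fq; have [q0|Qq|[_ Sq _]] := region_cases Fq.
  - by rewrite u_initial ?normr_ge0.
  - by rewrite (le_trans (ler_norm _))// (le_trans (uM0 _ Qq))// ler_norm.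
  - by rewrite (sol_dirichlet csol Sq) normr_ge0.
pose V (k : R) (x : 'rV[R]_N) (t : R) := (`|M| + 1) * t + k * (1 + dot x x + 2 * N%:R * t).
have weight_gt0 q : 0 <= q.2 -> 0 < 1 + dot q.1 q.1 + 2 * N%:R * q.2.
  by move=> q0; rewrite -addrA ltr_pwDl// addr_ge0 ?dot_ge0// !mulr_ge0.
suff bound (k : R) : 0 < k -> u p.1 p.2 <= V k p.1 p.2.
  apply/ler_addgt0Pr => e e0.
  have c0 := weight_gt0 p p0.
  have := bound (e / (1 + dot p.1 p.1 + 2 * N%:R * p.2)) (divr_gt0 e0 c0).
  by rewrite /V divfK ?gt_eqF.
move=> k0; rewrite leNgt; apply/negP => Vu.
have Vgt0 q : 0 <= q.2 -> 0 < V k q.1 q.2.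
  by move=> q0; rewrite /V ltr_wpDl ?mulr_ge0 ?addr_ge0// mulr_gt0// weight_gt0.
have cV : continuous (fun q => V k q.1 q.2).
  move=> q.
  have cfst : {for q, continuous (@fst 'rV[R]_N R)} by exact: cvg_fst.
  have csnd : {for q, continuous (@snd 'rV[R]_N R)} by exact: cvg_snd.
  have cst (a : R) : {for q, continuous (fun _ : 'rV[R]_N * R => a)}.
    exact: cst_continuous.
  have cdot := continuous_dot cfst cfst.
  exact: (continuousD (continuousM (cst _) csnd) (continuousM (cst _)
    (continuousD (continuousD (cst _) cdot) (continuousM (cst _) csnd)))).
pose Z := region `&` [set q | q.2 <= p.2] `&` setT `&`
          [set q | V k q.1 q.2 <= u q.1 q.2].
have cZ : closed Z by exact: contact_closed.
have bZ q : Z q -> `|q.1| <= Mu / k + 1 + T /\ `|q.2| <= Mu / k + 1 + T.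
  move=> [[[Fq qp] _] /= Vq]; have [/andP[q0 qT] _] := Fq.
  have Muk : 0 <= Mu / k := divr_ge0 (normr_ge0 _) (ltW k0).
  have hq : dot q.1 q.1 <= Mu / k.
    rewrite ler_pdivlMr// mulrC; have := le_trans Vq (uM q Fq).
    have h1 : 0 <= (`|M| + 1) * q.2 by rewrite mulr_ge0.
    have h2 : 0 <= k * (2 * N%:R * q.2) by rewrite !mulr_ge0// ltW.
    by rewrite /V !mulrDr mulr1; lra.
  rewrite (ger0_norm q0); split; last by lra.
  by have := norm_le_dot hq; lra.
have [q Zq Hq] := exists_first_time cZ bZ (ex_intro _ p (conj (conj (conj Fp (lexx _)) I) (ltW Vu))).
have [[[Fq qp] _] /= Vq] := Zq; have [/andP[q0 qT] _] := Fq.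
have [q00|Qq|[_ Sq _]] := region_cases Fq.
- by have := Vgt0 q q0; rewrite ltNge (le_trans Vq)// u_initial.
- have : (`|M| + 1 + k * (2 * N%:R)) - \sum_(i < N) (2 * k) <= f q.1 q.2.
    apply: (@interior_contact (V k) q (fun i h => k * (2 * q.1 0 i) + 2 * k * h)
      (fun=> 2 * k) _ Qq cV _ _ _ Vq).
    + move=> i h.
      have -> : (fun a => V k (q.1 + a *: delta_mx 0 i) q.2) =
        (fun a => V k q.1 q.2 + k * (2 * q.1 0 i) * a + k * a ^+ 2).
        apply/funext => a.
        rewrite /V !(dotDl, dotDr, dotZl, dotZr) (dotC (delta_mx 0 i)) !dot_delta.
        by rewrite mxE !eqxx /=; ring.
      by apply: is_derive_eq (is_derive_quadratic _ _ _ _) _; ring.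
    + move=> i.
      have -> : (fun h => k * (2 * q.1 0 i) + 2 * k * h) =
         (fun h => k * (2 * q.1 0 i) + 2 * k * h + 0 * h ^+ 2).
        by apply/funext => h; ring.
      by apply: is_derive_eq (is_derive_quadratic _ _ _ _) _; ring.
    + have -> : V k q.1 = (fun t => k * (1 + dot q.1 q.1) +
         (`|M| + 1 + k * (2 * N%:R)) * t + 0 * t ^+ 2).
        by apply/funext => t; rewrite /V; ring.
      by apply: is_derive_eq (is_derive_quadratic _ _ _ _) _; ring.
    + apply: filterS (Q_open Qq) => z Qz zq; rewrite ltNge; apply/negP => Vz.
      have : Z z.
        split => //; split => //; split; first exact: Q_region.
        exact: le_trans (ltW zq) qp.
      by move=> /Hq; rewrite leNgt zq.
  rewrite sumr_const card_ord -mulr_natr.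
  have [qT' _] := Qq; have := fM q.1 q.2 qT'; have := ler_norm M.
  by lra.
- by have := Vgt0 q q0; rewrite ltNge (le_trans Vq)// (sol_dirichlet csol Sq).
Qed.

(** * Comparison with a rising paraboloid *)

Section barrier.
Variables (K c0 c w b g : R).

(** The level set [phi = 0] is a paraboloid, which rises with speed [c]. *)
Definition phi (x : 'rV[R]_N) (t : R) : R :=
  dot x m + K * dot (tcoord m B x) (tcoord m B x) - c0 - (c * t - w).

Lemma phi_line x d (k t : R) :
  phi (x + k *: d) t = phi x t +
    (dot d m + 2 * K * dot (tcoord m B x) (tcoord m B d)) * k +
    K * dot (tcoord m B d) (tcoord m B d) * k ^+ 2.
Proof.
rewrite /phi (tcoordD hB) (tcoordZ hB) !(dotDl, dotDr, dotZl, dotZr).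
by rewrite (dotC (tcoord m B d) (tcoord m B x)); ring.
Qed.

Lemma phi_continuous : continuous (fun p => phi p.1 p.2).
Proof.
move=> p.
have csnd : {for p, continuous (@snd 'rV[R]_N R)} by exact: cvg_snd.
have cst (a : R) : {for p, continuous (fun _ : 'rV[R]_N * R => a)}.
  exact: cst_continuous.
have cm : {for p, continuous (fun q => dot q.1 m)}.
  by apply: continuous_dot; [exact: cvg_fst|exact: cst_continuous].
have cB := @continuous_tcoord_fst _ _ m B p.
have cBB := continuous_dot cB cB.
exact: (continuousB (continuousB (continuousD cm (continuousM (cst K) cBB)) (cst c0))
  (continuousB (continuousM (cst c) csnd) (cst w))).
Qed.

Definition barrier x t := profile b g (phi x t).

Lemma barrier_continuous : continuous (fun p => barrier p.1 p.2).
Proof.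
move=> p; have cp := @phi_continuous p.
have cst (a : R) : {for p, continuous (fun _ : 'rV[R]_N * R => a)}.
  exact: cst_continuous.
exact: (continuousB (continuousM (cst b) cp)
  (continuousM (cst g) (continuousM cp cp))).
Qed.

(** The profile contributes [2 g |grad phi|^2 >= 2 g] to [V_t - Lap V], the motion
and the curvature of the paraboloid at least [- b (c + 2 K N)]. *)
Lemma barrier_interior_contact p : 0 <= K -> 0 <= g -> 0 <= c ->
  Q p -> 0 <= phi p.1 p.2 -> 2 * g * phi p.1 p.2 <= b ->
  barrier p.1 p.2 <= u p.1 p.2 ->
  (\forall q \near p, q.2 < p.2 -> u q.1 q.2 < barrier q.1 q.2) ->
  2 * g <= f p.1 p.2 + b * (c + 2 * K * N%:R).
Proof.
move=> K0 g0 c_ge0 Qp phi0 phib Vu before.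
set Phi := phi p.1 p.2 in phi0 phib.
pose a i := dot (delta_mx 0 i) m +
  2 * K * dot (tcoord m B p.1) (tcoord m B (delta_mx 0 i)).
pose e i := dot (tcoord m B (delta_mx 0 i)) (tcoord m B (delta_mx 0 i)).
have dV1 i (h : R) : is_derive h 1 (fun k => barrier (p.1 + k *: delta_mx 0 i) p.2)
    ((b - 2 * g * (Phi + a i * h + (K * e i) * h ^+ 2)) * (a i + 2 * (K * e i) * h)).
  have -> : (fun k => barrier (p.1 + k *: delta_mx 0 i) p.2) =
      (fun k => profile b g (Phi + a i * k + (K * e i) * k ^+ 2)).
    by apply/funext => k; rewrite /barrier phi_line.
  exact: (is_derive_profile b g (is_derive_quadratic Phi (a i) (K * e i) h)).
have dVt : is_derive p.2 1 (barrier p.1) ((b - 2 * g * Phi) * - c).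
  have -> : barrier p.1 = (fun t => profile b g
      ((Phi + c * p.2) + (- c) * t + 0 * t ^+ 2)).
    by apply/funext => t; rewrite /barrier /Phi /phi; congr profile; ring.
  have H := is_derive_profile b g (is_derive_quadratic (Phi + c * p.2) (- c) 0 p.2).
  by apply: is_derive_eq H _; ring.
have := interior_contact Qp barrier_continuous dV1
  (fun i => is_derive_profile_slope b g Phi (a i) (K * e i) 0) dVt Vu before.
under eq_bigr do rewrite !mulr0 expr0n/= mulr0 !addr0.
rewrite big_split/= sumrN -!mulr_sumr.
have -> : \sum_(i < N) a i ^+ 2 = 1 + (2 * K) ^+ 2 *
    dot (tcoord m B p.1) (tcoord m B p.1) by exact: sum_sqr_grad_paraboloid.
have -> : \sum_(i < N) e i = N.-1%:R by exact: sum_dot_tcoord_delta.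
have h1 : 0 <= g * ((2 * K) ^+ 2 * dot (tcoord m B p.1) (tcoord m B p.1)).
  by rewrite !mulr_ge0// ?sqr_ge0// dot_ge0.
have h2 : 0 <= b - 2 * g * Phi by rewrite subr_ge0.
have h3 : b - 2 * g * Phi <= b by rewrite gerBl !mulr_ge0.
have h4 : (N.-1%:R : R) <= N%:R by rewrite ler_nat leq_pred.
have h5 : K * N.-1%:R <= K * N%:R by rewrite ler_wpM2l.
have h6 : 0 <= K * N.-1%:R by rewrite mulr_ge0.
have h7 : (b - 2 * g * Phi) * (c + 2 * (K * N.-1%:R)) <= b * (c + 2 * K * N%:R).
  by apply: ler_pM => //; lra.
by lra.
Qed.

(** Over the unit ball a unit vector sees [phi] grow with slope at most [1 + 2 K];
the third [K] absorbs the quadratic term. *)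
Lemma barrier_boundary_contact p : 0 < alpha -> 0 <= K -> 0 <= g -> 0 <= b ->
  0 < p.2 -> region p -> height (tcoord m B p.1) p.2 = dot p.1 m ->
  phi p.1 p.2 = 0 -> dot (tcoord m B p.1) (tcoord m B p.1) <= 1 ->
  (\forall q \near p, Q q -> q.2 < p.2 -> u q.1 q.2 < barrier q.1 q.2) ->
  3 / 4 * alpha <= b * (1 + 3 * K).
Proof.
move=> a0 K0 g0 b0 p0 Fp pm phi0 p1 before.
have [d dd] := boundary_contact p0 Fp pm barrier_continuous before.
have a40 : 0 < alpha / 4 by rewrite divr_gt0.
move=> /(_ _ a40)[r r0 Hr].
pose h := Num.min r 1 / 2.
have m0 : 0 < Num.min r 1 by rewrite lt_min r0 ltr01.
have h0 : 0 < h by rewrite divr_gt0.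
have : h < Num.min r 1 by rewrite /h; lra.
rewrite lt_min => /andP[hr h1].
(* At distance h from the contact, V is at least 3/4 alpha h, up to the choice of
   the error alpha / 4. *)
have := Hr h; rewrite h0 hr => /(_ isT); rewrite /barrier /profile phi_line phi0.
have := dot_decomposition hm hB d; rewrite dd.
set y := tcoord m B p.1 in p1 *; set z := tcoord m B d => dz.
have z0 := dot_ge0 z.
have yz : 2 * dot y z <= dot y y + dot z z.
  have := dot_ge0 (y - z).
  by rewrite !(dotDl, dotDr, dotNl, dotNr) (dotC z y); lra.
have dm : dot d m <= 1 by nra.
have dm2 := sqr_ge0 (dot d m).
have z1 : dot z z <= 1 by lra.
set X := (0 + _ + _) => HX.
have : X <= (1 + 3 * K) * h.
  rewrite /X add0r expr2 mulrA -mulrDl ler_pM2r// mulrDl mul1r -addrA lerD//.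
  have : K * (2 * dot y z) <= K * 2 by rewrite ler_wpM2l//; lra.
  have : K * dot z z * h <= K * 1.
    by rewrite -mulrA ler_wpM2l//; apply: mulr_ile1 => //; lra.
  by lra.
move=> /(ler_wpM2l b0) bX.
have gX : 0 <= g * X ^+ 2 by rewrite mulr_ge0// sqr_ge0.
by rewrite -(ler_pM2r h0); lra.
Qed.

Section comparison.
Variables (t0 dl : R).
Hypotheses (K_ge0 : 0 <= K) (c_gt0 : 0 < c) (b_gt0 : 0 < b) (g_gt0 : 0 < g).
Hypotheses (w_gt0 : 0 < w) (w_le : w <= 1 / 10) (dl_le : dl <= 1 / 4) (gdl : 2 * g * dl = b).
Hypotheses (t0_gt0 : 0 < t0) (t0T : t0 < T) (ct0 : c * t0 = 4 * w).
Hypothesis height_close : forall t y, 0 <= t <= t0 -> `|height y t - s0 y| < w.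
Hypothesis inside : forall y, dot y y <= 1 -> c0 <= s0 y + K * dot y y.
Hypothesis onsphere : forall y, dot y y = 1 -> c0 + 1 <= s0 y + K * dot y y.
Hypothesis u_lt_top : forall p, region p -> p.2 <= t0 ->
  u p.1 p.2 < profile b g dl.

Let sqr_tcoord p : R := dot (tcoord m B p.1) (tcoord m B p.1).

(** The layer in which [u] and the barrier are compared; it is bounded only
together with the region, which bounds it from below. *)
Definition window : set ('rV[R]_N * R) :=
  [set q | sqr_tcoord q <= 1 /\ phi q.1 q.2 <= dl].

Definition contact : set ('rV[R]_N * R) :=
  region `&` [set q | q.2 <= t0] `&` window `&`
    [set q | barrier q.1 q.2 <= u q.1 q.2].

Lemma sqr_tcoord_continuous : continuous sqr_tcoord.
Proof.
by move=> q; have cB := @continuous_tcoord_fst _ _ m B q; exact: (continuous_dot cB cB).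
Qed.

Lemma contact_set_closed : closed contact.
Proof.
apply: contact_closed => //; last exact: barrier_continuous.
have -> : window = [set q | sqr_tcoord q <= 1] `&` [set q | phi q.1 q.2 <= dl] by [].
apply: closedI.
- apply: (@closed_comp _ _ _ [set z : R | z <= 1]) => [q _|].
    exact: sqr_tcoord_continuous.
  exact: closed_le.
- apply: (@closed_comp _ _ _ [set z : R | z <= dl]) => [q _|].
    exact: phi_continuous.
  exact: closed_le.
Qed.

Lemma phi_lower q : region q -> q.2 <= t0 ->
  s0 (tcoord m B q.1) + K * sqr_tcoord q - c0 - 4 * w <= phi q.1 q.2.
Proof.
move=> [/andP[q0 qT] Fq] qt.
have := height_close (t := q.2) (tcoord m B q.1); rewrite q0 qt => /(_ isT).
have : c * q.2 <= 4 * w by rewrite -ct0 ler_pM2l.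
by rewrite ltr_norml /phi -/(sqr_tcoord q); lra.
Qed.

Lemma contact_bounded : exists C : R, forall q, contact q -> `|q.1| <= C /\ `|q.2| <= C.
Proof.
pose C := `|c0| + K + 10; exists (1 + C ^+ 2 + 1 + T).
move=> q [[[Fq qt] [qB qPhi]] _]; have [/andP[q0 qT] _] := Fq.
have C0 := sqr_ge0 C; rewrite (ger0_norm q0); split; last by lra.
have qm : - C <= dot q.1 m <= C.
  have := phi_lower Fq qt; have := inside qB; move: qPhi.
  have : c * q.2 <= 4 * w by rewrite -ct0 ler_pM2l.
  have := mulr_ge0 (ltW c_gt0) q0.
  have := ler_wpM2l K_ge0 qB; have := mulr_ge0 K_ge0 (dot_ge0 (tcoord m B q.1)).
  have := ler_norm c0; have := ler_norm (- c0); rewrite normrN.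
  by move: w_le dl_le w_gt0 K_ge0; rewrite /phi /C -/(sqr_tcoord q); lra.
have : dot q.1 q.1 <= 1 + C ^+ 2.
  rewrite (dot_decomposition hm hB) lerD//; have /andP[q1 q2] := qm.
  have : 0 <= (C - dot q.1 m) * (C + dot q.1 m).
    by rewrite mulr_ge0 ?subr_ge0// -lerBlDl sub0r.
  by rewrite -subr_sqr subr_ge0.
by move: hT => T0 /norm_le_dot; lra.
Qed.

(** Under the paraboloid the barrier is negative, and [u] is not. *)
Lemma contact_of_phi_lt0 q : region q -> q.2 <= t0 -> sqr_tcoord q <= 1 ->
  phi q.1 q.2 < 0 -> contact q.
Proof.
move=> Fq qt qB qphi; have dl0 : 0 < dl.
  by rewrite -(pmulr_rgt0 _ g_gt0); move: gdl b_gt0; lra.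
split; last first.
  by rewrite /= (le_trans _ (u_ge0 Fq))// profile_le0// ltW.
by split=> //; split=> //; rewrite (le_trans (ltW qphi))// ltW.
Qed.

(** The point of the free boundary above the point of tangency: at time [t0] the
paraboloid has risen to [3 w] above the tangency, the free boundary at most to
[w]. *)
Lemma contact_nonempty y : dot y y <= 1 -> s0 y + K * dot y y = c0 -> contact !=set0.
Proof.
move=> y1 yc; pose x := y *m B + height y t0 *: m.
have xB : tcoord m B x = y.
  by rewrite /x (tcoordD hB) (tcoordZ hB) (tcoord_axis hB) scaler0 addr0 (tcoord_frame hB).
have xm : dot x m = height y t0.
  by rewrite /x dotDl dotZl (dot_frame_axis hB) (dot_axis hm) add0r mulr1.
exists (x, t0); apply: contact_of_phi_lt0 => //=.
- by split=> /=; [rewrite (ltW t0_gt0)|rewrite xB xm].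
- by rewrite /sqr_tcoord xB.
- have := height_close (t := t0) y; rewrite (ltW t0_gt0) lexx => /(_ isT).
  by move: yc w_gt0; rewrite ltr_norml /phi xB xm ct0; lra.
Qed.

Section first_contact.
Variable q : 'rV[R]_N * R.
Hypotheses (cq : contact q) (first : forall z, contact z -> q.2 <= z.2).

Let Fq : region q. Proof. by case: cq => -[[]]. Qed.
Let qt : q.2 <= t0. Proof. by case: cq => -[[]]. Qed.
Let qB : sqr_tcoord q <= 1. Proof. by case: cq => -[_ []]. Qed.
Let q_phi : phi q.1 q.2 <= dl. Proof. by case: cq => -[_ []]. Qed.
Let q_le : barrier q.1 q.2 <= u q.1 q.2. Proof. by case: cq. Qed.

(** Over the unit sphere [phi] is at least [1 - 4 w >= 3 / 5] in the region, which is
more than [dl <= 1 / 4]. *)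
Lemma first_contact_sqr_tcoord_lt1 : sqr_tcoord q < 1.
Proof.
rewrite lt_neqAle qB andbT; apply/eqP => /onsphere.
by have := phi_lower Fq qt; move: q_phi w_le dl_le; rewrite -/(sqr_tcoord q); lra.
Qed.

Lemma first_contact_phi_lt : phi q.1 q.2 < dl.
Proof.
rewrite lt_neqAle q_phi andbT; apply/eqP => E.
by have := le_lt_trans q_le (u_lt_top Fq qt); rewrite /barrier E ltxx.
Qed.

Lemma first_contact_phi_le0 : u q.1 q.2 = 0 -> phi q.1 q.2 <= 0.
Proof.
move=> u0; rewrite leNgt; apply/negP => phi0.
have : 0 < barrier q.1 q.2.
  by apply: profile_gt0 => //; rewrite -gdl ler_pM2l ?mulr_gt0.
by rewrite ltNge (le_trans q_le)// u0.
Qed.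

Lemma first_contact_time_gt0 : 0 < q.2.
Proof.
have [/andP[q0 _] Fqh] := Fq; rewrite lt_neqAle q0 andbT.
apply/eqP => q00; have := first_contact_phi_le0 (u_initial Fq (esym q00)).
have := inside qB; move: Fqh w_gt0.
by rewrite /height -q00 lexx /phi mulr0; lra.
Qed.

(** Were the first contact strictly below the paraboloid, a slightly higher point of
the domain would be below it too, slightly earlier; it would be an earlier
contact. *)
Lemma first_contact_phi_ge0 : 0 < q.2 -> 0 <= phi q.1 q.2.
Proof.
move=> qpos; rewrite leNgt; apply/negP => phi0.
have [/andP[_ qT] Fqh] := Fq.
have [l [l0 lphi]] : exists l : R, 0 < l /\ phi q.1 q.2 = - (2 * l).
  by exists (- phi q.1 q.2 / 2); split; [lra|field].
pose z := q.1 + l *: m.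
have zB : tcoord m B z = tcoord m B q.1.
  by rewrite /z (tcoordD hB) (tcoordZ hB) (tcoord_axis hB) scaler0 addr0.
have zm : dot z m = dot q.1 m + l by rewrite /z dotDl dotZl (dot_axis hm) mulr1.
have [e e0 He] := near_norm (continuous_dist (@gap_continuous (z, q.2) qT) l0).
have [k [k0 ke kq kl]] : exists k : R, [/\ 0 < k, k < e, k < q.2 & k * c < l].
  pose k := Num.min (Num.min e q.2) (l / c).
  have k0 : 0 < k by rewrite !lt_min e0 qpos divr_gt0.
  exists (k / 2); have : k / 2 < k by rewrite ltr_pdivrMr// ltr_pMr// ltr1n.
  rewrite {2}/k !lt_min ltr_pdivlMr// => /andP[/andP[? ?] ?].
  by split=> //; rewrite divr_gt0.
have zq : q.2 - k < q.2 by rewrite gtrBl.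
suff : contact (z, q.2 - k) by move=> /first; rewrite leNgt zq.
apply: contact_of_phi_lt0 => /=.
- split=> /=; first by rewrite subr_ge0 (ltW kq) (lt_trans zq).
  have := He (z, q.2 - k); rewrite /= zB zm => H.
  have : `|(z, q.2) - (z, q.2 - k)| < e.
    by apply/prod_norm_lt; rewrite /= subrr normr0 opprB addrC subrK gtr0_norm.
  by move=> /H; rewrite ltr_norml; lra.
- exact: le_trans (ltW zq) qt.
- by rewrite /sqr_tcoord zB.
- have -> : phi z (q.2 - k) = phi q.1 q.2 + l + k * c.
    by rewrite /phi zB zm; ring.
  by rewrite lphi; lra.
Qed.

Lemma below_before_first_contact :
  \forall z \near q, region z -> z.2 < q.2 -> u z.1 z.2 < barrier z.1 z.2.
Proof.
have d1 : 0 < 1 - sqr_tcoord q by rewrite subr_gt0 first_contact_sqr_tcoord_lt1.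
have d2 : 0 < dl - phi q.1 q.2 by rewrite subr_gt0 first_contact_phi_lt.
apply: filterS2 (continuous_dist (@sqr_tcoord_continuous q) d1)
  (continuous_dist (@phi_continuous q) d2).
move=> z zB zphi Fz zq; rewrite ltNge; apply/negP => Vz.
suff : contact z by move=> /first; rewrite leNgt zq.
split=> //; split; first by split=> //; exact: le_trans (ltW zq) qt.
by split; [move: zB|move: zphi]; rewrite ltr_norml; lra.
Qed.

End first_contact.

Lemma barrier_not_reached y (M : R) :
  0 < alpha -> (forall x t, 0 < t < T -> f x t <= M) ->
  dot y y <= 1 -> s0 y + K * dot y y = c0 ->
  M + b * (c + 2 * (K * N%:R)) < 2 * g -> b * (1 + 3 * K) < 3 / 4 * alpha -> False.
Proof.
move=> a0 fM y1 yc gM bK; have [C bC] := contact_bounded.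
have [q cq first] := exists_first_time contact_set_closed bC (contact_nonempty y1 yc).
have [[[Fq qt] [qB _]] /= q_le] := cq.
have qpos := first_contact_time_gt0 cq.
have phi0 := first_contact_phi_ge0 cq first qpos.
have phidl := first_contact_phi_lt cq.
have before := below_before_first_contact cq first.
have [q0|Qq|[_ Sq pm]] := region_cases Fq; first by move: qpos; rewrite q0 ltxx.
- have bef : \forall z \near q, z.2 < q.2 -> u z.1 z.2 < barrier z.1 z.2.
    by apply: filterS2 (Q_open Qq) before => z Qz; apply; exact: Q_region.
  have phib : 2 * g * phi q.1 q.2 <= b by rewrite -gdl ler_pM2l ?mulr_gt0// ltW.
  have := barrier_interior_contact K_ge0 (ltW g_gt0) (ltW c_gt0) Qq phi0 phib q_le bef.
  have [qT' _] := Qq; have := fM q.1 q.2 qT'.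
  by lra.
- have u0 := sol_dirichlet csol Sq.
  have {}phi0 : phi q.1 q.2 = 0.
    by apply/eqP; rewrite eq_le phi0 andbT; exact: first_contact_phi_le0.
  have bef : \forall z \near q, Q z -> z.2 < q.2 -> u z.1 z.2 < barrier z.1 z.2.
    by apply: filterS before => z H Qz; apply: H; exact: Q_region.
  have := barrier_boundary_contact a0 K_ge0 (ltW g_gt0) (ltW b_gt0) qpos Fq pm phi0 qB bef.
  by rewrite leNgt bK.
Qed.

End comparison.
End barrier.

Lemma no_solution (M : R) : 0 < alpha ->
  (forall x t, 0 < t < T -> f x t <= M) -> False.
Proof.
move=> a0 fM.
have [K [c0 [y0 [K0 y01 y0c inball onsphere]]]] := paraboloid_touching_inside cs0.
have M1 : 1 <= `|M| + 1 by rewrite lerDr.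
have KN : 0 <= K * N%:R by rewrite mulr_ge0.
have [b [w [b0 bK /andP[w0 w10] small]]] := barrier_parameters a0 K0 KN M1 hT.
have [r r0 Hr] := height_near_initial w0.
have [t0 [c [g [dl [[t00 t0r t0T] [cpos ct0] [g0 g2] [/andP[dl0 dl4] gdl] top]]]]] :=
  small r r0.
apply: (@barrier_not_reached K c0 c w b g t0 dl _ _ _ _ _ _ _ _ _ _ _ _ _ _ _ y0 M) => //.
- by move=> t y /andP[t1 t2]; apply: Hr; rewrite t1 (le_lt_trans t2).
- move=> p Fp pt; apply: le_lt_trans (u_le_linear fM Fp) _.
  by apply: le_lt_trans top; rewrite ler_pM2l// (lt_le_trans ltr01).
- by rewrite g2 ltrD2r (le_lt_trans (ler_norm _))// ltrDl.
- by rewrite bK; lra.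
Qed.

End solution.

Theorem theorem1p4 (R : realType) (N : nat) (hN : (2 <= N)%N)
    (alpha T : R) (halpha : 0 < alpha) (hT : 0 < T)
    (f : 'rV[R]_N -> R -> R)
    (f_ge0 : forall x (t : R), 0 < t < T -> 0 <= f x t)
    (f_bounded : exists M : R, forall x (t : R), 0 < t < T -> f x t <= M)
    (f_measurable : st_measurable_fun [set p : 'rV[R]_N * R | 0 < p.2 < T]
                      (fun p => f p.1 p.2))
    (m : 'rV[R]_N) (hm : enorm m = 1)
    (B : 'M[R]_(N.-1, N)) (hB : hyperplane_frame m B)
    (s0 : 'rV[R]_N.-1 -> R) (s0_C2 : C2 s0)
    (s0_bounded : exists M : R, forall y,
       `|grad s0 y| <= M /\ `|hess s0 y| <= M) :
  ~ exists (u : 'rV[R]_N -> R -> R) (s : 'rV[R]_N.-1 -> R -> R),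
      initial_value_solution m B T alpha f (fun _ => 0) s0 u s.
Proof.
move=> [u [s sol]]; have [M fM] := f_bounded; have [_ cs0 _ _] := s0_C2.
exact: (no_solution hT hm hB cs0 sol halpha fM).
Qed.
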